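(* Let $p$ be a prime, $\mathbb{F}$ any field of characteristic $p$, and $G = C_p$ the cyclic group of order $p$. The following conditions are equivalent for a finitely generated $\underline{\mathbb{F}}$-module $M$: (1) $M$ is flat; (2) $M$ is projective; (3) $M$ is free.
   Context: Mackey and (commutative) Green functors for the finite group $G$ have their standard meaning. $\underline{\mathbb{F}}$ is the constant $G$-Tambara functor at $\mathbb{F}$: $\underline{\mathbb{F}}(G/H) = \mathbb{F}$ for all $H$, all restrictions are identities and the transfer $\mathrm{Tr}_H^K$ is multiplication by $[K:H]$ (norms are $[K:H]$-th powers). A module over a Tambara functor $k$ is a module over its underlying Green functor, and $\boxtimes_k$ is the relative box product. A $k$-module $M$ is flat if $M \boxtimes_k -$ is exact on $k$-modules. The free $k$-module on a generator in level $X$ ($X$ a finite $G$-set) is the $k$-module representing $M \mapsto M(X)$. A $k$-module is free if it is a direct sum of such modules, finitely generated if it is a quotient of a finite direct sum of such modules, and projective if it is a projective object of the abelian category of $k$-modules. *)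

(* Defs.v *)
From HB Require Import structures.
From mathcomp Require Import all_boot all_algebra all_fingroup generic_quotient.
From mathcomp Require Import boolp.

Set Implicit Arguments.
Unset Strict Implicit.
Unset Printing Implicit Defensive.

Import GRing.Theory.
Local Open Scope ring_scope.

(* Mackey functors are taken in Dress's form: bivariant functors on all finite
   G-sets, where G is the whole of [gT].  MathComp actions are right actions;
   inverting group elements identifies right with left G-sets. *)

Record gset (gT : finGroupType) := GSet {
  gset_sort :> finType;
  gset_act : {action gT &-> gset_sort} }.

Record gmap (gT : finGroupType) (X Y : gset gT) := GMap {
  gmap_fun :> X -> Y;
  gmap_equiv : forall x g,
    gmap_fun (gset_act X x g) = gset_act Y (gmap_fun x) g }.

Definition gid (gT : finGroupType) (X : gset gT) : gmap X X :=
  @GMap gT X X id (fun _ _ => erefl).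

Lemma gcomp_equiv (gT : finGroupType) (X Y Z : gset gT)
    (h : gmap Y Z) (f : gmap X Y) x g :
  h (f (gset_act X x g)) = gset_act Z (h (f x)) g.
Proof. by rewrite !gmap_equiv. Qed.

Definition gcomp (gT : finGroupType) (X Y Z : gset gT)
    (h : gmap Y Z) (f : gmap X Y) : gmap X Z :=
  GMap (@gcomp_equiv gT X Y Z h f).

(*            h'
        W ------> X
     f' |         | f
        v         v
        Y ------> Z
             h                 *)
Definition is_pullback (gT : finGroupType) (W X Y Z : gset gT)
    (f : gmap X Z) (h : gmap Y Z) (f' : gmap W Y) (h' : gmap W X) : Prop :=
  (forall w, f (h' w) = h (f' w)) /\
  (forall x y, f x = h y -> exists! w, h' w = x /\ f' w = y).

Definition is_coproduct (gT : finGroupType) (X Y Z : gset gT)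
    (i : gmap X Z) (j : gmap Y Z) : Prop :=
  bijective (fun s : X + Y => match s with inl x => i x | inr y => j y end).

(* Taking X, Y and Z all empty, [mackey_add] also gives V(0) = 0. *)
Record is_mackey (gT : finGroupType) (V : gset gT -> zmodType)
    (res : forall X Y : gset gT, gmap X Y -> V Y -> V X)
    (tr : forall X Y : gset gT, gmap X Y -> V X -> V Y) : Prop := IsMackey {
  mackey_res_id : forall X (m : V X), res _ _ (gid X) m = m;
  mackey_res_comp : forall X Y Z (h : gmap Y Z) (f : gmap X Y) (m : V Z),
    res _ _ (gcomp h f) m = res _ _ f (res _ _ h m);
  mackey_tr_id : forall X (m : V X), tr _ _ (gid X) m = m;
  mackey_tr_comp : forall X Y Z (h : gmap Y Z) (f : gmap X Y) (m : V X),
    tr _ _ (gcomp h f) m = tr _ _ h (tr _ _ f m);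
  mackey_pullback : forall W X Y Z (f : gmap X Z) (h : gmap Y Z)
      (f' : gmap W Y) (h' : gmap W X),
    is_pullback f h f' h' ->
    forall m : V X, res _ _ h (tr _ _ f m) = tr _ _ f' (res _ _ h' m);
  mackey_add : forall X Y Z (i : gmap X Z) (j : gmap Y Z),
    is_coproduct i j ->
    forall (a : V X) (b : V Y),
      exists! c : V Z, res _ _ i c = a /\ res _ _ j c = b }.

(* The rings are allowed to be trivial because k(0) = 0. *)
Record cgreen (gT : finGroupType) := CGreen {
  gval :> gset gT -> comPzRingType;
  gres : forall X Y : gset gT, gmap X Y -> {rmorphism gval Y -> gval X};
  gtr : forall X Y : gset gT, gmap X Y -> {additive gval X -> gval Y};
  green_mackey : @is_mackey gT gval (fun X Y f => gres f) (fun X Y f => gtr f);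
  green_frobenius : forall X Y (f : gmap X Y) (a : gval X) (b : gval Y),
    gtr f (a * gres f b) = gtr f a * b }.

Record kmod (gT : finGroupType) (k : cgreen gT) := KMod {
  mval :> forall X : gset gT, lmodType (k X);
  mres : forall X Y : gset gT, gmap X Y -> {additive mval Y -> mval X};
  mtr : forall X Y : gset gT, gmap X Y -> {additive mval X -> mval Y};
  kmod_mackey : @is_mackey gT mval (fun X Y f => mres f) (fun X Y f => mtr f);
  mresZ : forall X Y (f : gmap X Y) (a : k Y) (m : mval Y),
    mres f (a *: m) = gres k f a *: mres f m;
  mtr_frobl : forall X Y (f : gmap X Y) (a : k X) (m : mval Y),
    mtr f (a *: mres f m) = gtr k f a *: m;
  mtr_frobr : forall X Y (f : gmap X Y) (a : k Y) (m : mval X),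
    mtr f (gres k f a *: m) = a *: mtr f m }.

Record khom (gT : finGroupType) (k : cgreen gT) (M N : kmod k) := KHom {
  hval :> forall X : gset gT, {linear M X -> N X};
  hval_res : forall X Y (f : gmap X Y) (m : M Y),
    hval X (mres M f m) = mres N f (hval Y m);
  hval_tr : forall X Y (f : gmap X Y) (m : M X),
    hval Y (mtr M f m) = mtr N f (hval X m) }.

Definition exists_unique_khom (gT : finGroupType) (k : cgreen gT)
    (M N : kmod k) (P : khom M N -> Prop) : Prop :=
  exists2 phi, P phi & forall psi, P psi -> forall X m, psi X m = phi X m.

Definition ksurjective (gT : finGroupType) (k : cgreen gT) (M N : kmod k)
    (f : khom M N) : Prop :=
  forall X (n : N X), exists m : M X, f X m = n.

(* Kernels and images of maps of k-modules are computed levelwise. *)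
Definition short_exact (gT : finGroupType) (k : cgreen gT) (L M N : kmod k)
    (f : khom L M) (g : khom M N) : Prop :=
  [/\ forall X, injective (f X),
      forall X (m : M X), g X m = 0 <-> exists l, f X l = m &
      ksurjective g].

(* A k-bilinear Dress pairing M, N -> P; such pairings are the maps from the
   box product of M and N that factor through the relative box product. *)
Record pairing (gT : finGroupType) (k : cgreen gT) (M N P : kmod k) := Pairing {
  pval :> forall X : gset gT, M X -> N X -> P X;
  pairDl : forall X (m m' : M X) (n : N X),
    pval (m + m') n = pval m n + pval m' n;
  pairDr : forall X (m : M X) (n n' : N X),
    pval m (n + n') = pval m n + pval m n';
  pairZl : forall X (a : k X) (m : M X) (n : N X),
    pval (a *: m) n = a *: pval m n;
  pairZr : forall X (a : k X) (m : M X) (n : N X),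
    pval m (a *: n) = a *: pval m n;
  pair_res : forall X Y (f : gmap X Y) (m : M Y) (n : N Y),
    mres P f (pval m n) = pval (mres M f m) (mres N f n);
  pair_frobl : forall X Y (f : gmap X Y) (m : M X) (n : N Y),
    mtr P f (pval m (mres N f n)) = pval (mtr M f m) n;
  pair_frobr : forall X Y (f : gmap X Y) (m : M Y) (n : N X),
    mtr P f (pval (mres M f m) n) = pval m (mtr N f n) }.

(* [theta] exhibits P as the relative box product of M and N over k; it exists
   by [relbox_exists] below and is unique up to unique isomorphism. *)
Definition is_relbox (gT : finGroupType) (k : cgreen gT) (M N P : kmod k)
    (theta : pairing M N P) : Prop :=
  forall (Q : kmod k) (eta : pairing M N Q),
    exists_unique_khom (fun phi : khom P Q =>
      forall X (m : M X) (n : N X), phi X (theta X m n) = eta X m n).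

(* u is the map induced by f on relative box products with M. *)
Definition is_relbox_map (gT : finGroupType) (k : cgreen gT)
    (M N N' P P' : kmod k) (theta : pairing M N P) (theta' : pairing M N' P')
    (f : khom N N') (u : khom P P') : Prop :=
  forall X (m : M X) (n : N X), u X (theta X m n) = theta' X m (f X n).

Definition kflat (gT : finGroupType) (k : cgreen gT) (M : kmod k) : Prop :=
  forall (N1 N2 N3 : kmod k) (f : khom N1 N2) (g : khom N2 N3),
    short_exact f g ->
  forall (P1 P2 P3 : kmod k) (theta1 : pairing M N1 P1)
      (theta2 : pairing M N2 P2) (theta3 : pairing M N3 P3),
    is_relbox theta1 -> is_relbox theta2 -> is_relbox theta3 ->
  forall (u : khom P1 P2) (v : khom P2 P3),
    is_relbox_map theta1 theta2 f u -> is_relbox_map theta2 theta3 g v ->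
    short_exact u v.

Definition kprojective (gT : finGroupType) (k : cgreen gT) (M : kmod k) : Prop :=
  forall (N N' : kmod k) (e : khom N N') (f : khom M N'),
    ksurjective e ->
    exists h : khom M N, forall X (m : M X), e X (h X m) = f X m.

(* u in P(X) makes P represent the functor N |-> N(X). *)
Definition free_on (gT : finGroupType) (k : cgreen gT) (P : kmod k)
    (X : gset gT) (u : P X) : Prop :=
  forall (N : kmod k) (n : N X),
    exists_unique_khom (fun phi : khom P N => phi X u = n).

Definition free_on_generator (gT : finGroupType) (k : cgreen gT) (P : kmod k) :
    Prop :=
  exists (X : gset gT) (u : P X), free_on u.

Definition is_direct_sum (gT : finGroupType) (k : cgreen gT) (I : Type)
    (P : I -> kmod k) (M : kmod k) (inj : forall i, khom (P i) M) : Prop :=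
  forall (N : kmod k) (f : forall i, khom (P i) N),
    exists_unique_khom (fun phi : khom M N =>
      forall i X (x : P i X), phi X (inj i X x) = f i X x).

Definition kfree (gT : finGroupType) (k : cgreen gT) (M : kmod k) : Prop :=
  exists (I : Type) (P : I -> kmod k) (inj : forall i, khom (P i) M),
    (forall i, free_on_generator (P i)) /\ is_direct_sum inj.

Definition kfinitely_generated (gT : finGroupType) (k : cgreen gT)
    (M : kmod k) : Prop :=
  exists (n : nat) (P : 'I_n -> kmod k) (S : kmod k)
      (inj : forall i, khom (P i) S) (q : khom S M),
    [/\ forall i, free_on_generator (P i), is_direct_sum inj & ksurjective q].

(* The constant Green functor of a ring R sends X to the ring of G-invariant
   functions X -> R, with restriction along f given by composition and transfer
   by summation over the fibres of f.  For X = G/H these functions are the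
   constants, so the value is R; along G/H -> G/K restriction is then the
   identity and transfer is multiplication by the fibre size #|K : H|. *)
Section Constant.
Variables (gT : finGroupType) (R : comPzRingType).

Definition cst_inv (X : gset gT) : {pred {ffun X -> R}} :=
  fun a => [forall x, forall g, a (gset_act X x g) == a x].
Arguments cst_inv : clear implicits.

Lemma cst_invP (X : gset gT) (a : {ffun X -> R}) :
  reflect (forall x g, a (gset_act X x g) = a x) (a \in cst_inv X).
Proof.
by apply: (iffP forallP) => H x; [move=> g; apply/eqP/(forallP (H x))
  |apply/forallP => g; apply/eqP].
Qed.

Lemma cst_inv_subring (X : gset gT) : subring_closed (cst_inv X).
Proof.
split=> [|a b /cst_invP Ha /cst_invP Hb|a b /cst_invP Ha /cst_invP Hb];
  by apply/cst_invP => x g; rewrite !ffunE ?Ha ?Hb.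
Qed.

HB.instance Definition _ (X : gset gT) :=
  GRing.isSubringClosed.Build {ffun X -> R} (cst_inv X) (@cst_inv_subring X).

Record cst_val (X : gset gT) := CstVal {
  cst_fun : {ffun X -> R};
  cst_funP : cst_fun \in cst_inv X }.

HB.instance Definition _ (X : gset gT) := [isSub of cst_val X for @cst_fun X].
HB.instance Definition _ (X : gset gT) := [Choice of cst_val X by <:].
HB.instance Definition _ (X : gset gT) :=
  GRing.SubChoice_isSubPzRing.Build {ffun X -> R} (cst_inv X) (cst_val X)
    (@cst_inv_subring X).

Lemma cst_funE (X : gset gT) (a : cst_val X) x g :
  cst_fun a (gset_act X x g) = cst_fun a x.
Proof. exact/cst_invP/cst_funP. Qed.

Lemma cst_eq (X : gset gT) (a b : cst_val X) :
  (forall x, cst_fun a x = cst_fun b x) -> a = b.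
Proof. by move=> H; apply/val_inj/ffunP. Qed.

Lemma cst_mulC (X : gset gT) : commutative (@GRing.mul (cst_val X)).
Proof. by move=> a b; apply: cst_eq => x; rewrite !ffunE mulrC. Qed.

HB.instance Definition _ (X : gset gT) :=
  GRing.PzRing_hasCommutativeMul.Build (cst_val X) (@cst_mulC X).

Section Maps.
Variables (X Y : gset gT) (f : gmap X Y).

Lemma cst_res_inv (b : cst_val Y) :
  [ffun x => cst_fun b (f x)] \in cst_inv X.
Proof. by apply/cst_invP => x g; rewrite !ffunE gmap_equiv cst_funE. Qed.
Definition cst_res (b : cst_val Y) : cst_val X := CstVal (cst_res_inv b).

Lemma cst_tr_inv (a : cst_val X) :
  [ffun y => \sum_(x | f x == y) cst_fun a x] \in cst_inv Y.
Proof.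
apply/cst_invP => y g; rewrite !ffunE.
rewrite (reindex_inj (@act_inj _ _ _ (gset_act X) g)) /=.
apply: eq_big => [x|x _]; last exact: cst_funE.
by rewrite gmap_equiv (inj_eq (@act_inj _ _ _ (gset_act Y) g)).
Qed.
Definition cst_tr (a : cst_val X) : cst_val Y := CstVal (cst_tr_inv a).

Lemma cst_res_additive : zmod_morphism cst_res.
Proof. by move=> a b; apply: cst_eq => x; rewrite !ffunE. Qed.
Lemma cst_res_multiplicative : monoid_morphism cst_res.
Proof. by split=> [|a b]; apply: cst_eq => x; rewrite !ffunE. Qed.
Lemma cst_tr_additive : zmod_morphism cst_tr.
Proof.
move=> a b; apply: cst_eq => y; rewrite !ffunE -sumrB.
by apply: eq_bigr => x _; rewrite !ffunE.
Qed.
HB.instance Definition _ :=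
  GRing.isZmodMorphism.Build (cst_val Y) (cst_val X) cst_res cst_res_additive.
HB.instance Definition _ :=
  GRing.isMonoidMorphism.Build (cst_val Y) (cst_val X) cst_res
    cst_res_multiplicative.
HB.instance Definition _ :=
  GRing.isZmodMorphism.Build (cst_val X) (cst_val Y) cst_tr cst_tr_additive.
End Maps.

Lemma cst_mackey :
  @is_mackey gT cst_val (fun X Y f => cst_res f) (fun X Y f => cst_tr f).
Proof.
split.
- by move=> X a; apply: cst_eq => x; rewrite ffunE.
- by move=> X Y Z h f a; apply: cst_eq => x; rewrite !ffunE.
- move=> X a; apply: cst_eq => x; rewrite ffunE.
  by rewrite (eq_bigl (pred1 x)) ?big_pred1_eq.
- move=> X Y Z h f a; apply: cst_eq => z; rewrite !ffunE.
  rewrite (partition_big f (fun y => h y == z)) //=.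
  apply: eq_bigr => y /eqP hy; rewrite ffunE; apply: eq_bigl => x.
  by apply/andP/eqP => [[_ /eqP]//|/= ->]; rewrite hy eqxx.
- move=> W X Y Z f h f' h' [comm lift] a; apply: cst_eq => y; rewrite !ffunE.
  rewrite [RHS](eq_bigr (fun w => cst_fun a (h' w))); last first.
    by move=> w _; rewrite ffunE.
  rewrite [RHS](partition_big h' (fun x => f x == h y)); last first.
    by move=> w /eqP <-; rewrite comm.
  apply: eq_bigr => x /eqP fx /=.
  have [w [[h'w f'w] uw]] := lift _ _ fx.
  rewrite (big_pred1 w) ?h'w // => v.
  apply/andP/eqP => [[/eqP f'v /eqP h'v]|->]; last by rewrite f'w h'w !eqxx.
  by apply/esym/uw.
- move=> X Y Z i j [s sK Ks] a b.
  pose c0 z := match s z with inl x => cst_fun a x | inr y => cst_fun b y end.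
  have ci x : c0 (i x) = cst_fun a x by rewrite /c0 (sK (inl x)).
  have cj y : c0 (j y) = cst_fun b y by rewrite /c0 (sK (inr y)).
  have cP : [ffun z => c0 z] \in cst_inv Z.
    apply/cst_invP => z g; rewrite !ffunE -(Ks z).
    by case: (s z) => [x|y]; rewrite -gmap_equiv ?ci ?cj cst_funE.
  exists (CstVal cP); split.
    by split; apply: cst_eq => x; rewrite !ffunE ?ci ?cj.
  move=> d [da db]; apply: cst_eq => z; rewrite ffunE /c0; move: (Ks z).
  by case: (s z) => x zE; rewrite -?da -?db ffunE zE.
Qed.

Lemma cst_frobenius (X Y : gset gT) (f : gmap X Y) a b :
  cst_tr f (a * cst_res f b) = cst_tr f a * b.
Proof.
apply: cst_eq => y; rewrite !ffunE mulr_suml; apply: eq_bigr => x /eqP <-.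
by rewrite !ffunE.
Qed.

Definition constant_green : cgreen gT :=
  @CGreen gT cst_val (fun X Y f => cst_res f) (fun X Y f => cst_tr f)
    cst_mackey cst_frobenius.

End Constant.

(* Existence of relative box products, by a coend over a small skeleton of
   finite G-sets.  An element at level X is a formal sum of symbols f_*(m (x) n)
   for f : Y -> X with Y carried by some 'I_n, and two sums are identified when
   every pairing out of M and N gives them the same value. *)
Section RelboxExists.
Variables (gT : finGroupType) (k : cgreen gT) (M N : kmod k).
Implicit Types X Y : gset gT.

Section Reindex.
Variable X : gset gT.

Definition ord_act (i : 'I_#|X|) (g : gT) : 'I_#|X| :=
  enum_rank (gset_act X (enum_val i) g).

Lemma ord_act1 : ord_act^~ 1%g =1 id.
Proof. by move=> i; rewrite /ord_act act1 enum_valK. Qed.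

Lemma ord_actM i : act_morph ord_act i.
Proof. by move=> g h; rewrite /ord_act enum_rankK actM. Qed.

Definition ord_gset : gset gT := GSet (TotalAction ord_act1 ord_actM).

Lemma ord_gset_equiv (i : ord_gset) g :
  enum_val (gset_act ord_gset i g) = gset_act X (enum_val i) g.
Proof. exact: enum_rankK. Qed.

Definition ord_map : gmap ord_gset X :=
  @GMap gT ord_gset X (fun i : 'I_#|X| => enum_val i) ord_gset_equiv.

End Reindex.

Lemma tr_ord_mapK (P : kmod k) X (z : P X) :
  mtr P (ord_map X) (mres P (ord_map X) z) = z.
Proof.
have pb : is_pullback (gid X) (gid X) (ord_map X) (ord_map X).
  split=> // x y /= <-; exists (enum_rank x); split=> [|i [<- _]] /=.
    by rewrite enum_rankK.
  exact: enum_valK.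
rewrite -(mackey_pullback (kmod_mackey P) pb).
by rewrite (mackey_tr_id (kmod_mackey P)) (mackey_res_id (kmod_mackey P)).
Qed.

Section Fibre.
Variables (X Y Z : gset gT) (f : gmap X Z) (h : gmap Y Z).

Let fib := {p : X * Y | f p.1 == h p.2}.

Lemma fib_act_proof (p : fib) g :
  f (gset_act X (val p).1 g) == h (gset_act Y (val p).2 g).
Proof. by rewrite !gmap_equiv (eqP (valP p)). Qed.

Definition fib_act (p : fib) g : fib :=
  exist (fun q : X * Y => f q.1 == h q.2)
    (gset_act X (val p).1 g, gset_act Y (val p).2 g) (fib_act_proof p g).

Lemma fib_act1 : fib_act^~ 1%g =1 id.
Proof. by move=> p; apply/val_inj; rewrite /= !act1 -surjective_pairing. Qed.

Lemma fib_actM p : act_morph fib_act p.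
Proof. by move=> a b; apply/val_inj; rewrite /= !actM. Qed.

Definition fib_gset : gset gT := GSet (TotalAction fib_act1 fib_actM).

Definition fib1 : gmap fib_gset X :=
  @GMap gT fib_gset X (fun p : fib => (val p).1) (fun _ _ => erefl).
Definition fib2 : gmap fib_gset Y :=
  @GMap gT fib_gset Y (fun p : fib => (val p).2) (fun _ _ => erefl).

Definition ofib1 := gcomp fib1 (ord_map fib_gset).
Definition ofib2 := gcomp fib2 (ord_map fib_gset).

Lemma ofib_pullback : is_pullback f h ofib2 ofib1.
Proof.
split=> [w|x y fxy]; first by rewrite /= (eqP (valP (enum_val w))).
have pP : f (x, y).1 == h (x, y).2 by apply/eqP.
exists (enum_rank (exist _ (x, y) pP : fib_gset)); split=> /=.
  by rewrite enum_rankK.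
move=> w [w1 w2]; apply: enum_val_inj; rewrite enum_rankK.
by apply/val_inj; rewrite /= -w1 -w2 -surjective_pairing.
Qed.

End Fibre.

Record symb X := Symb {
  symb_n : nat;
  symb_act : {action gT &-> 'I_symb_n};
  symb_map : gmap (GSet symb_act) X;
  symb_l : M (GSet symb_act);
  symb_r : N (GSet symb_act) }.

Notation sums X := (seq {classic (symb X)}).

Definition sym1 X (Q : kmod k) (eta : pairing M N Q) (c : symb X) : Q X :=
  mtr Q (symb_map c) (eta _ (symb_l c) (symb_r c)).

Definition symv X (Q : kmod k) (eta : pairing M N Q) (s : sums X) : Q X :=
  \sum_(c <- s) sym1 eta c.

Definition sym_equiv X (s t : sums X) : bool :=
  `[< forall (Q : kmod k) (eta : pairing M N Q), symv eta s = symv eta t >].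

Lemma sym_equiv_refl X : reflexive (@sym_equiv X).
Proof. by move=> s; apply/asboolP. Qed.
Lemma sym_equiv_sym X : symmetric (@sym_equiv X).
Proof. by move=> s t; apply/asboolP/asboolP => H Q eta; rewrite H. Qed.
Lemma sym_equiv_trans X : transitive (@sym_equiv X).
Proof.
by move=> t s u /asboolP H1 /asboolP H2; apply/asboolP => Q eta; rewrite H1.
Qed.

Canonical sym_equivr X := EquivRel (@sym_equiv X)
  (@sym_equiv_refl X) (@sym_equiv_sym X) (@sym_equiv_trans X).

Definition bx X := {eq_quot (sym_equivr X)}%qT.
HB.instance Definition _ X := Choice.on (bx X).

Definition bxpi X (s : sums X) : bx X := \pi_(bx X)%qT s.
Definition bxv X (Q : kmod k) (eta : pairing M N Q) (x : bx X) : Q X :=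
  symv eta (repr x).

Lemma bxvE X (Q : kmod k) (eta : pairing M N Q) (s : sums X) :
  bxv eta (bxpi s) = symv eta s.
Proof.
have : (repr (bxpi s) == s %[mod bx X])%qT by rewrite reprK.
by rewrite /bxv eqmodE => /asboolP ->.
Qed.

Lemma bx_inj X (x y : bx X) :
  (forall (Q : kmod k) (eta : pairing M N Q), bxv eta x = bxv eta y) -> x = y.
Proof.
move=> H; rewrite -[x]reprK -[y]reprK; apply/eqmodP/asboolP => Q eta.
exact: H.
Qed.

Lemma symv_cat X (Q : kmod k) (eta : pairing M N Q) (s t : sums X) :
  symv eta (s ++ t) = symv eta s + symv eta t.
Proof. exact: big_cat. Qed.

Lemma symv_map X Y (Q : kmod k) (eta : pairing M N Q)
    (F : {additive Q X -> Q Y}) (u : symb X -> symb Y) (s : sums X) :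
  (forall c, sym1 eta (u c) = F (sym1 eta c)) ->
  symv eta (map u s : sums Y) = F (symv eta s).
Proof.
by move=> H; rewrite /symv big_map raddf_sum; apply: eq_bigr => c _.
Qed.

Definition symN X (c : symb X) : symb X :=
  Symb (symb_map c) (- symb_l c) (symb_r c).
Definition symZ X (a : k X) (c : symb X) : symb X :=
  Symb (symb_map c) (gres k (symb_map c) a *: symb_l c) (symb_r c).
Definition symT X Y (f : gmap X Y) (c : symb X) : symb Y :=
  Symb (gcomp f (symb_map c)) (symb_l c) (symb_r c).
Definition symR X Y (f : gmap X Y) (c : symb Y) : symb X :=
  @Symb X _ (gset_act (ord_gset (fib_gset (symb_map c) f)))
    (ofib2 (symb_map c) f)
    (mres M (ofib1 (symb_map c) f) (symb_l c))
    (mres N (ofib1 (symb_map c) f) (symb_r c)).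

Lemma pairNl (Q : kmod k) (eta : pairing M N Q) X (m : M X) (n : N X) :
  eta X (- m) n = - eta X m n.
Proof. by rewrite -scaleN1r pairZl scaleN1r. Qed.

Definition bx0 X : bx X := bxpi [::].
Definition bxN X (x : bx X) : bx X := bxpi (map (@symN X) (repr x)).
Definition bxD X (x y : bx X) : bx X := bxpi (repr x ++ repr y).
Definition bxZ X (a : k X) (x : bx X) : bx X := bxpi (map (symZ a) (repr x)).
Definition bxT X Y (f : gmap X Y) (x : bx X) : bx Y :=
  bxpi (map (symT f) (repr x)).
Definition bxR X Y (f : gmap X Y) (x : bx Y) : bx X :=
  bxpi (map (symR f) (repr x)).

Section Value.
Variables (Q : kmod k) (eta : pairing M N Q).

Lemma bxv0 X : bxv eta (bx0 X) = 0.
Proof. by rewrite bxvE /symv big_nil. Qed.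
Lemma bxvD X (x y : bx X) : bxv eta (bxD x y) = bxv eta x + bxv eta y.
Proof. by rewrite bxvE symv_cat. Qed.
Lemma bxvN X (x : bx X) : bxv eta (bxN x) = - bxv eta x.
Proof.
rewrite bxvE (@symv_map _ _ _ _ (-%R)) // => c.
by rewrite /sym1 /= pairNl raddfN.
Qed.
Lemma bxvZ X a (x : bx X) : bxv eta (bxZ a x) = a *: bxv eta x.
Proof.
rewrite bxvE (@symv_map _ _ _ _ ( *:%R a)) // => c.
by rewrite /sym1 /= pairZl mtr_frobr.
Qed.
Lemma bxvT X Y (f : gmap X Y) (x : bx X) :
  bxv eta (bxT f x) = mtr Q f (bxv eta x).
Proof.
rewrite bxvE (@symv_map _ _ _ _ (mtr Q f)) // => c.
by rewrite /sym1 /= (mackey_tr_comp (kmod_mackey Q)).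
Qed.
Lemma bxvR X Y (f : gmap X Y) (x : bx Y) :
  bxv eta (bxR f x) = mres Q f (bxv eta x).
Proof.
rewrite bxvE (@symv_map _ _ _ _ (mres Q f)) // => c.
rewrite /sym1 (mackey_pullback (kmod_mackey Q) (ofib_pullback _ f)).
by rewrite pair_res.
Qed.
End Value.

Definition bxvS := (bxv0, bxvD, bxvN, bxvZ, bxvT, bxvR).

Section Level.
Variable X : gset gT.
Lemma bx_addA : associative (@bxD X).
Proof. by move=> x y z; apply: bx_inj => Q eta; rewrite !bxvS addrA. Qed.
Lemma bx_addC : commutative (@bxD X).
Proof. by move=> x y; apply: bx_inj => Q eta; rewrite !bxvS addrC. Qed.
Lemma bx_add0 : left_id (bx0 X) (@bxD X).
Proof. by move=> x; apply: bx_inj => Q eta; rewrite !bxvS add0r. Qed.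
Lemma bx_addN : left_inverse (bx0 X) (@bxN X) (@bxD X).
Proof. by move=> x; apply: bx_inj => Q eta; rewrite !bxvS addNr. Qed.
HB.instance Definition _ := GRing.isZmodule.Build (bx X)
  bx_addA bx_addC bx_add0 bx_addN.

Lemma bx_scaleA a b (x : bx X) : bxZ a (bxZ b x) = bxZ (a * b) x.
Proof. by apply: bx_inj => Q eta; rewrite !bxvS scalerA. Qed.
Lemma bx_scale1 : left_id 1 (@bxZ X).
Proof. by move=> x; apply: bx_inj => Q eta; rewrite !bxvS scale1r. Qed.
Lemma bx_scaleDr : right_distributive (@bxZ X) +%R.
Proof. by move=> a x y; apply: bx_inj => Q eta; rewrite !bxvS scalerDr. Qed.
Lemma bx_scaleDl (x : bx X) : {morph (@bxZ X)^~ x : a b / a + b}.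
Proof. by move=> a b; apply: bx_inj => Q eta; rewrite !bxvS scalerDl. Qed.
HB.instance Definition _ := GRing.Zmodule_isLmodule.Build (k X) (bx X)
  bx_scaleA bx_scale1 bx_scaleDr bx_scaleDl.
End Level.

Section Maps.
Variables (X Y : gset gT) (f : gmap X Y).
Lemma bxR_additive : zmod_morphism (bxR f).
Proof. by move=> x y; apply: bx_inj => Q eta; rewrite !bxvS raddfB. Qed.
Lemma bxT_additive : zmod_morphism (bxT f).
Proof. by move=> x y; apply: bx_inj => Q eta; rewrite !bxvS raddfB. Qed.
HB.instance Definition _ :=
  GRing.isZmodMorphism.Build (bx Y) (bx X) (bxR f) bxR_additive.
HB.instance Definition _ :=
  GRing.isZmodMorphism.Build (bx X) (bx Y) (bxT f) bxT_additive.
End Maps.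

Lemma kmod_add0 (Q : kmod k) X Y Z (i : gmap X Z) (j : gmap Y Z) (z z' : Q Z) :
  is_coproduct i j -> mres Q i z = mres Q i z' -> mres Q j z = mres Q j z' ->
  z = z'.
Proof.
move=> ij ei ej.
have [c [_ uc]] := mackey_add (kmod_mackey Q) ij (mres Q i z) (mres Q j z).
by rewrite -(uc z) // (uc z').
Qed.

Lemma inj_pullback X Z (i : gmap X Z) :
  injective i -> is_pullback i i (gid X) (gid X).
Proof.
by move=> inj; split=> // x y /inj <-; exists x; split=> // w [].
Qed.

Lemma res_trK (Q : kmod k) X Z (i : gmap X Z) (a : Q X) :
  injective i -> mres Q i (mtr Q i a) = a.
Proof.
move=> /inj_pullback pb; rewrite (mackey_pullback (kmod_mackey Q) pb).
by rewrite (mackey_tr_id (kmod_mackey Q)) (mackey_res_id (kmod_mackey Q)).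
Qed.

Lemma res_tr0 (Q : kmod k) X Y Z (i : gmap X Z) (j : gmap Y Z) (a : Q X) :
  (forall x y, i x <> j y) -> mres Q j (mtr Q i a) = 0.
Proof.
move=> dij; set W := ord_gset (fib_gset i j).
rewrite (mackey_pullback (kmod_mackey Q) (ofib_pullback i j)).
set b := mres _ _ _.
have W0 (w : W) : False by case: (enum_val w) => p /eqP /dij.
have cop : is_coproduct (gid W) (gid W).
  by exists (fun w => False_rect _ (W0 w)) => [[] w|w]; case: (W0 w).
have [d [[]]] := mackey_add (kmod_mackey Q) cop b 0.
rewrite !(mackey_res_id (kmod_mackey Q)) => -> -> _; exact: raddf0.
Qed.

Lemma bx_mackey :
  @is_mackey gT bx (fun X Y f => bxR f) (fun X Y f => bxT f).
Proof.
split.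
- move=> X x; apply: bx_inj => Q eta.
  by rewrite !bxvS (mackey_res_id (kmod_mackey Q)).
- move=> X Y Z h f x; apply: bx_inj => Q eta.
  by rewrite !bxvS (mackey_res_comp (kmod_mackey Q)).
- move=> X x; apply: bx_inj => Q eta.
  by rewrite !bxvS (mackey_tr_id (kmod_mackey Q)).
- move=> X Y Z h f x; apply: bx_inj => Q eta.
  by rewrite !bxvS (mackey_tr_comp (kmod_mackey Q)).
- move=> W X Y Z f h f' h' pb x; apply: bx_inj => Q eta.
  by rewrite !bxvS (mackey_pullback (kmod_mackey Q) pb).
move=> X Y Z i j ij a b.
have inj_ij := bij_inj ij.
have inj_i : injective i by move=> x y e; have [] := inj_ij (inl x) (inl y) e.
have inj_j : injective j by move=> x y e; have [] := inj_ij (inr x) (inr y) e.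
have dij x y : i x <> j y by move=> e; have := inj_ij (inl x) (inr y) e.
have dji y x : j y <> i x by move=> e; apply: (dij x y).
exists (bxD (bxT i a) (bxT j b)); split.
  split; apply: bx_inj => Q eta; rewrite !bxvS raddfD /= res_trK //.
    by rewrite res_tr0 // addr0.
  by rewrite res_tr0 // add0r.
move=> c [<- <-]; apply: bx_inj => Q eta.
by apply: (kmod_add0 ij); rewrite !bxvS raddfD /= res_trK // res_tr0 //
  ?addr0 ?add0r.
Qed.

Definition bx_kmod : kmod k.
Proof.
refine (@KMod gT k bx (fun X Y f => bxR f) (fun X Y f => bxT f)
  bx_mackey _ _ _).
- by move=> X Y f a x; apply: bx_inj => Q eta; rewrite !bxvS mresZ.
- by move=> X Y f a x; apply: bx_inj => Q eta; rewrite !bxvS mtr_frobl.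
- by move=> X Y f a x; apply: bx_inj => Q eta; rewrite !bxvS mtr_frobr.
Defined.

Definition bx_pair X (m : M X) (n : N X) : bx X :=
  bxpi [:: @Symb X _ (gset_act (ord_gset X)) (ord_map X)
             (mres M (ord_map X) m) (mres N (ord_map X) n)].

Lemma bxv_pair (Q : kmod k) (eta : pairing M N Q) X (m : M X) (n : N X) :
  bxv eta (bx_pair m n) = eta X m n.
Proof. by rewrite bxvE /symv big_seq1 /sym1 /= -pair_res tr_ord_mapK. Qed.

Definition bx_pairing : pairing M N bx_kmod.
Proof.
refine (@Pairing gT k M N bx_kmod bx_pair _ _ _ _ _ _ _) => X.
- by move=> m m' n; apply: bx_inj => Q eta; rewrite !(bxvS, bxv_pair) pairDl.
- by move=> m n n'; apply: bx_inj => Q eta; rewrite !(bxvS, bxv_pair) pairDr.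
- by move=> a m n; apply: bx_inj => Q eta; rewrite !(bxvS, bxv_pair) pairZl.
- by move=> a m n; apply: bx_inj => Q eta; rewrite !(bxvS, bxv_pair) pairZr.
- by move=> Y f m n; apply: bx_inj => Q eta; rewrite !(bxvS, bxv_pair) pair_res.
- move=> Y f m n; apply: bx_inj => Q eta.
  by rewrite !(bxvS, bxv_pair) pair_frobl.
- move=> Y f m n; apply: bx_inj => Q eta.
  by rewrite !(bxvS, bxv_pair) pair_frobr.
Defined.

Section Induced.
Variables (Q : kmod k) (eta : pairing M N Q).
Lemma bxv_linear X : linear (bxv eta : bx_kmod X -> Q X).
Proof. by move=> a x y; rewrite !bxvS. Qed.
HB.instance Definition _ X := GRing.isLinear.Build (k X) (bx_kmod X) (Q X) _
  (bxv eta : bx_kmod X -> Q X) (@bxv_linear X).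
Definition bx_hom : khom bx_kmod Q :=
  @KHom gT k bx_kmod Q (fun X => bxv eta : {linear bx_kmod X -> Q X})
    (fun X Y f m => bxvR eta f m) (fun X Y f m => bxvT eta f m).
End Induced.

Lemma relbox_exists : exists (P : kmod k) (theta : pairing M N P),
  is_relbox theta.
Proof.
exists bx_kmod, bx_pairing => Q eta.
exists (bx_hom eta) => [X m n|psi psiE X x]; first exact: bxv_pair.
have -> : x = bxpi (repr x) by rewrite /bxpi reprK.
elim: (repr x) => [|c s IHs].
  have -> : bxpi [::] = 0 :> bx_kmod X by [].
  by rewrite !raddf0.
have -> : bxpi (c :: s) =
    (mtr bx_kmod (symb_map c) (bx_pairing _ (symb_l c) (symb_r c))
     + (bxpi s : bx_kmod X)) :> bx_kmod X.
  apply: bx_inj => Q' eta'; rewrite !(bxvS, bxv_pair) !bxvE.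
  exact: big_cons.
apply: (etrans (raddfD (psi X) _ _)).
apply: (etrans _ (esym (raddfD (bx_hom eta X) _ _))).
congr (_ + _); last exact: IHs.
apply: (etrans (hval_tr psi _ _)).
apply: (etrans _ (esym (hval_tr (bx_hom eta) _ _))).
by rewrite psiE /= bxv_pair.
Qed.

End RelboxExists.

(* Main.v *)
(* Write k for the constant functor, k_X = k(X * -) for the free module on a
   generator in level X, G for the regular G-set and g - 1 for the difference
   operator of a generator g on level G.  Since M (x) k_X = M(X * -), free
   modules on one generator are flat, and so are their retracts; a finitely
   generated projective is such a retract.
   Conversely, exactness of M (x) - on kernels of maps between k_pt and k_G
   shows that for M flat the restriction M(pt) -> M(G) is injective and that
   every element of M(G) of transfer zero lies in (g - 1) M(G) + res M(pt).
   Let v in M(X) generate M with #|X| minimal.  A nonzero kernel of k_X -> M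
   contains a G-fixed vector, i.e. a relation between the transfers of the
   components of v on the orbits of X.  If a fixed point occurs in it, that
   point can be dropped from X; otherwise, by the second property and Nakayama
   for the nilpotent operator g - 1, a free orbit can be replaced by a fixed
   point.  Both contradict minimality, so M is free on v. *)
Require Import Defs.
From HB Require Import structures.
From mathcomp Require Import all_boot all_algebra all_fingroup all_solvable.
From mathcomp Require Import generic_quotient boolp.

Set Implicit Arguments.
Unset Strict Implicit.
Unset Printing Implicit Defensive.

Import GRing.Theory.
Local Open Scope ring_scope.

(** * Finite G-sets *)

Section Gsets.
Variable gT : finGroupType.
Implicit Types X Y Z : gset gT.

Lemma gmap_eq X Y (f h : gmap X Y) : f =1 h -> f = h.
Proof.
case: f h => [f Hf] [h Hh] /= /funext fh; case: _ / fh Hh => Hh.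
by congr GMap; apply: Prop_irrelevance.
Qed.

Definition prod_act X Y (p : X * Y) (g : gT) : X * Y :=
  (gset_act X p.1 g, gset_act Y p.2 g).
Lemma prod_act1 X Y : (@prod_act X Y)^~ 1%g =1 id.
Proof. by case=> x y; rewrite /prod_act !act1. Qed.
Lemma prod_actM X Y p : act_morph (@prod_act X Y) p.
Proof. by move=> g h; rewrite /prod_act !actM. Qed.
Definition gprod X Y : gset gT :=
  GSet (TotalAction (@prod_act1 X Y) (@prod_actM X Y)).

Definition gfst X Y : gmap (gprod X Y) X :=
  @GMap gT (gprod X Y) X fst (fun _ _ => erefl).
Definition gsnd X Y : gmap (gprod X Y) Y :=
  @GMap gT (gprod X Y) Y snd (fun _ _ => erefl).
Lemma gpair_equiv Z X Y (f : gmap Z X) (h : gmap Z Y) z g :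
  (f (gset_act Z z g), h (gset_act Z z g)) =
  gset_act (gprod X Y) (f z, h z) g.
Proof. by rewrite !gmap_equiv. Qed.
Definition gpair Z X Y (f : gmap Z X) (h : gmap Z Y) : gmap Z (gprod X Y) :=
  @GMap gT Z (gprod X Y) (fun z => (f z, h z)) (gpair_equiv f h).
Definition gtimes X Y X' Y' (f : gmap X X') (h : gmap Y Y') :
    gmap (gprod X Y) (gprod X' Y') :=
  gpair (gcomp f (gfst X Y)) (gcomp h (gsnd X Y)).

Definition triv_act (T : Type) (x : T) (_ : gT) := x.
Lemma triv_actM T x : act_morph (@triv_act T) x. Proof. by []. Qed.
Definition gpt : gset gT :=
  GSet (@TotalAction gT unit (@triv_act unit) (fun _ => erefl)
          (@triv_actM unit)).
Definition to_pt X : gmap X gpt :=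
  @GMap gT X gpt (fun _ => tt) (fun _ _ => erefl).

Lemma to_pt_comp X Y (f : gmap X Y) : gcomp (to_pt Y) f = to_pt X.
Proof. exact: gmap_eq. Qed.

Lemma regact1 : (@mulg gT)^~ 1%g =1 id. Proof. exact: mulg1. Qed.
Lemma regactM x : act_morph (@mulg gT) x.
Proof. by move=> g h; rewrite mulgA. Qed.
Definition greg : gset gT := GSet (TotalAction regact1 regactM).

Lemma orb_equiv X (x : X) (h g : greg) :
  gset_act X x (gset_act greg h g) = gset_act X (gset_act X x h) g.
Proof. exact: actM. Qed.
(** Maps out of the regular G-set correspond to points of X; restriction along [orb x] is the
    component of an element at x. *)
Definition orb X (x : X) : gmap greg X :=
  @GMap gT greg X (fun h => gset_act X x h) (orb_equiv x).
(** Left translation by g; it commutes with the right action, and every endomorphism of the regular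
    G-set has this form. *)
Definition lam (g : gT) : gmap greg greg := orb (g : greg).

Lemma fixpt_equiv X (x : X) (fx : forall g, gset_act X x g = x) (t : gpt) g :
  x = gset_act X x g.
Proof. by rewrite fx. Qed.
Definition fixpt X (x : X) (fx : forall g, gset_act X x g = x) : gmap gpt X :=
  @GMap gT gpt X (fun _ => x) (fixpt_equiv fx).

Definition sum_act X Y (s : X + Y) (g : gT) : X + Y :=
  match s with
  | inl x => inl (gset_act X x g)
  | inr y => inr (gset_act Y y g)
  end.
Lemma sum_act1 X Y : (@sum_act X Y)^~ 1%g =1 id.
Proof. by case=> x; rewrite /= act1. Qed.
Lemma sum_actM X Y s : act_morph (@sum_act X Y) s.
Proof. by move=> g h; case: s => x; rewrite /= actM. Qed.
Definition gsum X Y : gset gT :=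
  GSet (TotalAction (@sum_act1 X Y) (@sum_actM X Y)).
Definition ginl X Y : gmap X (gsum X Y) :=
  @GMap gT X (gsum X Y) inl (fun _ _ => erefl).
Definition ginr X Y : gmap Y (gsum X Y) :=
  @GMap gT Y (gsum X Y) inr (fun _ _ => erefl).
Lemma gsum_coproduct X Y : is_coproduct (ginl X Y) (ginr X Y).
Proof. by exists id; case. Qed.

Definition gempty : gset gT :=
  GSet (@TotalAction gT void (@triv_act void) (fun _ => erefl)
          (@triv_actM void)).

Section Complement.
Variables (Y X : gset gT) (i : gmap Y X).
Let T := {x : X | x \notin codom i}.
Lemma compl_act_proof (x : T) g : gset_act X (val x) g \notin codom i.
Proof.
apply/negP => /codomP [y E]; case/negP: (valP x); apply/codomP.
by exists (gset_act Y y g^-1%g); rewrite gmap_equiv -E -actM mulgV act1.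
Qed.
Definition compl_act (x : T) g : T :=
  exist (fun y : X => y \notin codom i) _ (compl_act_proof x g).
Lemma compl_act1 : compl_act^~ 1%g =1 id.
Proof. by move=> x; apply: val_inj; rewrite /= act1. Qed.
Lemma compl_actM x : act_morph compl_act x.
Proof. by move=> g h; apply: val_inj; rewrite /= actM. Qed.
Definition gcompl : gset gT := GSet (TotalAction compl_act1 compl_actM).
Definition gcompl_map : gmap gcompl X :=
  @GMap gT gcompl X (fun x : T => val x) (fun _ _ => erefl).

Lemma gcompl_coproduct : injective i -> is_coproduct i gcompl_map.
Proof.
move=> inj_i; apply: inj_card_bij => [[y|x] [y'|x'] /= E|].
- by rewrite (inj_i _ _ E).
- by have := svalP x'; rewrite -E codom_f.
- by have := svalP x; rewrite E codom_f.
- by congr inr; apply: val_inj.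
rewrite card_sum card_sig -(card_codom inj_i) -(cardC (mem (codom i))).
by apply: eq_leq; congr addn; apply: eq_card => x; rewrite !inE.
Qed.
End Complement.

End Gsets.

Arguments gpt {gT}.
Arguments greg {gT}.
Arguments gempty {gT}.

(** * Consequences of the Mackey axioms *)

Section Mackey.
Variables (gT : finGroupType) (k : cgreen gT).
Implicit Types X Y Z : gset gT.
Implicit Types M N P Q : kmod k.

Lemma mres_id M X m : mres M (gid X) m = m.
Proof. exact: mackey_res_id (kmod_mackey M) _ _. Qed.
Lemma mtr_id M X m : mtr M (gid X) m = m.
Proof. exact: mackey_tr_id (kmod_mackey M) _ _. Qed.
Lemma mres_comp M X Y Z (h : gmap Y Z) (f : gmap X Y) m :
  mres M f (mres M h m) = mres M (gcomp h f) m.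
Proof. by rewrite (mackey_res_comp (kmod_mackey M)). Qed.
Lemma mtr_comp M X Y Z (h : gmap Y Z) (f : gmap X Y) m :
  mtr M h (mtr M f m) = mtr M (gcomp h f) m.
Proof. by rewrite (mackey_tr_comp (kmod_mackey M)). Qed.
Lemma gres_id X (a : k X) : gres k (gid X) a = a.
Proof. exact: mackey_res_id (green_mackey k) _ _. Qed.
Lemma gres_comp X Y Z (h : gmap Y Z) (f : gmap X Y) (a : k Z) :
  gres k f (gres k h a) = gres k (gcomp h f) a.
Proof. by rewrite (mackey_res_comp (green_mackey k)). Qed.
Lemma mtr_pullback M W X Y Z (f : gmap X Z) (h : gmap Y Z)
    (f' : gmap W Y) (h' : gmap W X) m : is_pullback f h f' h' ->
  mres M h (mtr M f m) = mtr M f' (mres M h' m).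
Proof.
by move=> pb; apply: mackey_pullback (kmod_mackey M) _ _ _ _ _ _ _ _ pb _.
Qed.

(** Both sides have the same restrictions to X and Y: a transfer from a summand restricts to the
    identity on that summand and to zero on the other one. *)
Lemma mackey_decomp M X Y Z (i : gmap X Z) (j : gmap Y Z) (m : M Z) :
  is_coproduct i j -> m = mtr M i (mres M i m) + mtr M j (mres M j m).
Proof.
move=> ij; have inj_ij := bij_inj ij.
have inj_i : injective i by move=> x y e; have [] := inj_ij (inl x) (inl y) e.
have inj_j : injective j by move=> x y e; have [] := inj_ij (inr x) (inr y) e.
have dij x y : i x <> j y by move=> e; have := inj_ij (inl x) (inr y) e.
have dji y x : j y <> i x by move=> e; apply: (dij x y).
apply: (kmod_add0 ij); rewrite raddfD /= res_trK //.
  by rewrite res_tr0 // addr0.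
by rewrite res_tr0 // add0r.
Qed.

(** An empty X is the coproduct of two copies of itself along identities, so some element restricts
    both to m and to 0 along the same identity map. *)
Lemma kmod_card0 M X (m : M X) : #|X| = 0%N -> m = 0.
Proof.
move=> X0; have x0 (x : X) : False by have := fintype0 x X0.
have cop : is_coproduct (gid X) (gid X).
  by exists (fun x => False_rect _ (x0 x)) => [[] x|x]; case: (x0 x).
have [d [[]]] := mackey_add (kmod_mackey M) cop m 0.
by rewrite !mres_id => -> ->.
Qed.

End Mackey.

(** * Submodules and quotients *)

Section Submodules.
Variables (gT : finGroupType) (k : cgreen gT).
Implicit Types X Y Z : gset gT.

Record ksub (M : kmod k) := KSub {
  kin :> forall X, M X -> Prop;
  kin0 : forall X, kin (0 : M X);
  kinP : forall X (a : k X) (x y : M X), kin x -> kin y -> kin (a *: x + y);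
  kin_res : forall X Y (f : gmap X Y) (m : M Y), kin m -> kin (mres M f m);
  kin_tr : forall X Y (f : gmap X Y) (m : M X), kin m -> kin (mtr M f m) }.

Section Closure.
Variables (M : kmod k) (R : ksub M).
Lemma kinD X (x y : M X) : R X x -> R X y -> R X (x + y).
Proof. by rewrite -{2}[x]scale1r; apply: kinP. Qed.
Lemma kinZ X a (x : M X) : R X x -> R X (a *: x).
Proof. by move=> Rx; rewrite -[_ *: _]addr0; apply: kinP (kin0 _ _). Qed.
Lemma kinN X (x : M X) : R X x -> R X (- x).
Proof. by rewrite -scaleN1r; apply: kinZ. Qed.
Lemma kinB X (x y : M X) : R X x -> R X y -> R X (x - y).
Proof. by move=> Rx /kinN; apply: kinD. Qed.
End Closure.

Section SubKmod.
Variables (M : kmod k) (R : ksub M).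

Definition ksub_pred X : {pred M X} := fun m => `[< R X m >].
Arguments ksub_pred : clear implicits.
Lemma ksub_predP X m : reflect (R X m) (m \in ksub_pred X).
Proof. exact: asboolP. Qed.
Lemma ksub_submod X : submod_closed (ksub_pred X).
Proof.
split; first exact/ksub_predP/kin0.
by move=> a x y /ksub_predP Rx /ksub_predP Ry; apply/ksub_predP/kinP.
Qed.
HB.instance Definition _ X :=
  GRing.isSubmodClosed.Build (k X) (M X) (ksub_pred X) (ksub_submod X).

Record ksub_val X := KSubVal {
  ksub_elt : M X;
  ksub_eltP : ksub_elt \in ksub_pred X }.
HB.instance Definition _ X := [isSub of ksub_val X for @ksub_elt X].
HB.instance Definition _ X := [Choice of ksub_val X by <:].
HB.instance Definition _ X := [SubChoice_isSubLmodule of ksub_val X by <:].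

Lemma ksub_val_inj X : injective (@ksub_elt X). Proof. exact: val_inj. Qed.
Lemma ksub_valP X (x : ksub_val X) : R X (ksub_elt x).
Proof. exact/ksub_predP/ksub_eltP. Qed.
Definition ksub_mk X m (Rm : R X m) : ksub_val X :=
  KSubVal (introT (ksub_predP m) Rm).

Section Maps.
Variables (X Y : gset gT) (f : gmap X Y).
Definition ksub_res (x : ksub_val Y) : ksub_val X :=
  ksub_mk (kin_res f (ksub_valP x)).
Definition ksub_tr (x : ksub_val X) : ksub_val Y :=
  ksub_mk (kin_tr f (ksub_valP x)).
Lemma ksub_res_additive : zmod_morphism ksub_res.
Proof. by move=> x y; apply: ksub_val_inj; rewrite /= !raddfB. Qed.
Lemma ksub_tr_additive : zmod_morphism ksub_tr.
Proof. by move=> x y; apply: ksub_val_inj; rewrite /= !raddfB. Qed.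
HB.instance Definition _ :=
  GRing.isZmodMorphism.Build (ksub_val Y) (ksub_val X) ksub_res
    ksub_res_additive.
HB.instance Definition _ :=
  GRing.isZmodMorphism.Build (ksub_val X) (ksub_val Y) ksub_tr
    ksub_tr_additive.
End Maps.

Lemma ksub_mackey :
  @is_mackey gT ksub_val (fun X Y f => ksub_res f) (fun X Y f => ksub_tr f).
Proof.
split.
- by move=> X x; apply: ksub_val_inj; rewrite /= mres_id.
- by move=> X Y Z h f x; apply: ksub_val_inj; rewrite /= mres_comp.
- by move=> X x; apply: ksub_val_inj; rewrite /= mtr_id.
- by move=> X Y Z h f x; apply: ksub_val_inj; rewrite /= mtr_comp.
- move=> W X Y Z f h f' h' pb x; apply: ksub_val_inj => /=.
  exact: mtr_pullback.
move=> X Y Z i j ij a b.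
have [c [[ca cb] uc]] :=
  mackey_add (kmod_mackey M) ij (ksub_elt a) (ksub_elt b).
(* The glued element stays in the submodule because it is the sum of the transfers of its two
   restrictions. *)
have Rc : R Z c.
  rewrite (mackey_decomp c ij) ca cb.
  by apply: kinD; apply: kin_tr; apply: ksub_valP.
exists (ksub_mk Rc); split; first by split; apply: ksub_val_inj.
by move=> d [da db]; apply: ksub_val_inj; apply: uc; rewrite -da -db.
Qed.

Definition ksub_kmod : kmod k.
Proof.
refine (@KMod gT k ksub_val (fun X Y f => ksub_res f) (fun X Y f => ksub_tr f)
  ksub_mackey _ _ _).
- by move=> X Y f a x; apply: ksub_val_inj; rewrite /= mresZ.
- by move=> X Y f a x; apply: ksub_val_inj; rewrite /= mtr_frobl.
- by move=> X Y f a x; apply: ksub_val_inj; rewrite /= mtr_frobr.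
Defined.

Lemma ksub_elt_linear X : linear (@ksub_elt X : ksub_kmod X -> M X).
Proof. by []. Qed.
HB.instance Definition _ X := GRing.isLinear.Build (k X) (ksub_kmod X) (M X) _
  (@ksub_elt X : ksub_kmod X -> M X) (@ksub_elt_linear X).
Definition ksub_incl : khom ksub_kmod M :=
  @KHom gT k ksub_kmod M (fun X => @ksub_elt X : {linear ksub_kmod X -> M X})
    (fun X Y f m => erefl) (fun X Y f m => erefl).

Section Corestrict.
Variables (L : kmod k) (f : khom L M) (fR : forall X l, R X (f X l)).
Definition ksub_lift_fun X (l : L X) : ksub_kmod X := ksub_mk (fR l).
Lemma ksub_lift_linear X : linear (@ksub_lift_fun X).
Proof. by move=> a x y; apply: ksub_val_inj; rewrite /= linearP. Qed.
HB.instance Definition _ X := GRing.isLinear.Build (k X) (L X) (ksub_kmod X) _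
  (@ksub_lift_fun X) (@ksub_lift_linear X).
Definition ksub_lift : khom L ksub_kmod.
Proof.
refine (@KHom gT k L ksub_kmod
  (fun X => @ksub_lift_fun X : {linear _ -> _}) _ _).
- by move=> X Y h m; apply: ksub_val_inj; rewrite /= hval_res.
- by move=> X Y h m; apply: ksub_val_inj; rewrite /= hval_tr.
Defined.
End Corestrict.
End SubKmod.

(** * Quotient modules, computed levelwise *)

Section Quotient.
Variables (M : kmod k) (R : ksub M).

Section Level.
Variable X : gset gT.
Definition kq_equiv (x y : M X) : bool := `[< R X (x - y) >].
Lemma kq_refl : reflexive kq_equiv.
Proof. by move=> x; apply/asboolP; rewrite subrr; apply: kin0. Qed.
Lemma kq_sym : symmetric kq_equiv.
Proof. by move=> x y; apply/asboolP/asboolP => /kinN; rewrite opprB. Qed.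
Lemma kq_trans : transitive kq_equiv.
Proof.
move=> y x z /asboolP xy /asboolP yz; apply/asboolP.
by rewrite -(subrKA y); apply: kinD.
Qed.
Canonical kq_equivr := EquivRel kq_equiv kq_refl kq_sym kq_trans.
Definition kq := {eq_quot kq_equivr}%qT.
HB.instance Definition _ := Choice.on kq.
Definition kqpi (x : M X) : kq := \pi_(kq)%qT x.
Lemma kq_eqP x y : kqpi x = kqpi y <-> R X (x - y).
Proof.
split=> [/eqP|H]; last by apply/eqmodP/asboolP.
by rewrite /kqpi eqmodE => /asboolP.
Qed.
Lemma kqpi_surj (u : kq) : exists x, u = kqpi x.
Proof. by exists (repr u); rewrite /kqpi reprK. Qed.

Definition kq_add (u v : kq) := kqpi (repr u + repr v).
Definition kq_opp (u : kq) := kqpi (- repr u).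
Definition kq_scale (a : k X) (u : kq) := kqpi (a *: repr u).
Lemma kq_repr x : R X (repr (kqpi x) - x).
Proof. by apply/kq_eqP; rewrite /kqpi reprK. Qed.
Lemma kq_addE x y : kq_add (kqpi x) (kqpi y) = kqpi (x + y).
Proof. by apply/kq_eqP; rewrite opprD addrACA; apply: kinD; apply: kq_repr. Qed.
Lemma kq_oppE x : kq_opp (kqpi x) = kqpi (- x).
Proof. by apply/kq_eqP; rewrite -opprD; apply: kinN; apply: kq_repr. Qed.
Lemma kq_scaleE a x : kq_scale a (kqpi x) = kqpi (a *: x).
Proof. by apply/kq_eqP; rewrite -scalerBr; apply: kinZ; apply: kq_repr. Qed.

Lemma kq_addA : associative kq_add.
Proof.
move=> u v w.
have [[x ->] [y ->] [z ->]] := And3 (kqpi_surj u) (kqpi_surj v) (kqpi_surj w).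
by rewrite !kq_addE addrA.
Qed.
Lemma kq_addC : commutative kq_add.
Proof.
move=> u v; have [[x ->] [y ->]] := (kqpi_surj u, kqpi_surj v).
by rewrite !kq_addE addrC.
Qed.
Lemma kq_add0 : left_id (kqpi 0) kq_add.
Proof. by move=> u; have [x ->] := kqpi_surj u; rewrite kq_addE add0r. Qed.
Lemma kq_addN : left_inverse (kqpi 0) kq_opp kq_add.
Proof.
by move=> u; have [x ->] := kqpi_surj u; rewrite kq_oppE kq_addE addNr.
Qed.
HB.instance Definition _ := GRing.isZmodule.Build kq
  kq_addA kq_addC kq_add0 kq_addN.

Lemma kq_scaleA a b u : kq_scale a (kq_scale b u) = kq_scale (a * b) u.
Proof. by have [x ->] := kqpi_surj u; rewrite !kq_scaleE scalerA. Qed.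
Lemma kq_scale1 : left_id 1 kq_scale.
Proof. by move=> u; have [x ->] := kqpi_surj u; rewrite kq_scaleE scale1r. Qed.
Lemma kq_scaleDr : right_distributive kq_scale +%R.
Proof.
move=> a u v; have [[x ->] [y ->]] := (kqpi_surj u, kqpi_surj v).
rewrite [X in kq_scale _ X]kq_addE !kq_scaleE [RHS]kq_addE.
by rewrite scalerDr.
Qed.
Lemma kq_scaleDl u : {morph kq_scale^~ u : a b / a + b}.
Proof.
move=> a b; have [x ->] := kqpi_surj u.
by rewrite !kq_scaleE [RHS]kq_addE scalerDl.
Qed.
HB.instance Definition _ := GRing.Zmodule_isLmodule.Build (k X) kq
  kq_scaleA kq_scale1 kq_scaleDr kq_scaleDl.
Lemma kqpi_linear : linear (kqpi : M X -> kq).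
Proof. by move=> a x y; rewrite -kq_addE -kq_scaleE. Qed.
HB.instance Definition _ := GRing.isLinear.Build (k X) (M X) kq _
  kqpi kqpi_linear.
End Level.

Section Maps.
Variables (X Y : gset gT) (f : gmap X Y).
Definition kq_res (u : kq Y) : kq X := kqpi (mres M f (repr u)).
Definition kq_tr (u : kq X) : kq Y := kqpi (mtr M f (repr u)).
Lemma kq_resE x : kq_res (kqpi x) = kqpi (mres M f x).
Proof. by apply/kq_eqP; rewrite -raddfB; apply: kin_res; apply: kq_repr. Qed.
Lemma kq_trE x : kq_tr (kqpi x) = kqpi (mtr M f x).
Proof. by apply/kq_eqP; rewrite -raddfB; apply: kin_tr; apply: kq_repr. Qed.
Lemma kq_res_additive : zmod_morphism kq_res.
Proof.
move=> u v; have [[x ->] [y ->]] := (kqpi_surj u, kqpi_surj v).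
by rewrite -raddfB !kq_resE !raddfB.
Qed.
Lemma kq_tr_additive : zmod_morphism kq_tr.
Proof.
move=> u v; have [[x ->] [y ->]] := (kqpi_surj u, kqpi_surj v).
by rewrite -raddfB !kq_trE !raddfB.
Qed.
HB.instance Definition _ :=
  GRing.isZmodMorphism.Build (kq Y) (kq X) kq_res kq_res_additive.
HB.instance Definition _ :=
  GRing.isZmodMorphism.Build (kq X) (kq Y) kq_tr kq_tr_additive.
End Maps.

Lemma kq_mackey :
  @is_mackey gT kq (fun X Y f => kq_res f) (fun X Y f => kq_tr f).
Proof.
split.
- by move=> X u; have [x ->] := kqpi_surj u; rewrite kq_resE mres_id.
- by move=> X Y Z h f u; have [x ->] := kqpi_surj u; rewrite !kq_resE mres_comp.
- by move=> X u; have [x ->] := kqpi_surj u; rewrite kq_trE mtr_id.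
- by move=> X Y Z h f u; have [x ->] := kqpi_surj u; rewrite !kq_trE mtr_comp.
- move=> W X Y Z f h f' h' pb u; have [x ->] := kqpi_surj u.
  by rewrite !(kq_resE, kq_trE) (mtr_pullback _ pb).
move=> X Y Z i j ij u v; have [[x ->] [y ->]] := (kqpi_surj u, kqpi_surj v).
have [c [[ca cb] uc]] := mackey_add (kmod_mackey M) ij x y.
exists (kqpi c); split; first by rewrite !kq_resE ca cb.
move=> w; have [d ->] := kqpi_surj w.
rewrite !kq_resE => -[/kq_eqP di /kq_eqP dj].
(* Uniqueness: c - d is the sum of the transfers of its restrictions, which lie in R. *)
apply/kq_eqP; rewrite (mackey_decomp (c - d) ij) !raddfB ca cb.
by apply: kinD; rewrite -raddfB; apply: kin_tr; rewrite -opprB; apply: kinN.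
Qed.

Definition kquot : kmod k.
Proof.
refine (@KMod gT k kq (fun X Y f => kq_res f) (fun X Y f => kq_tr f)
  kq_mackey _ _ _).
- move=> X Y f a u; have [x ->] := kqpi_surj u => /=.
  by rewrite -linearZ !kq_resE -linearZ mresZ.
- move=> X Y f a u; have [x ->] := kqpi_surj u => /=.
  by rewrite kq_resE -!linearZ kq_trE mtr_frobl.
- move=> X Y f a u; have [x ->] := kqpi_surj u => /=.
  by rewrite -linearZ !kq_trE -linearZ mtr_frobr.
Defined.

HB.instance Definition _ X := GRing.isLinear.Build (k X) (M X) (kquot X) _
  (@kqpi X : M X -> kquot X) (@kqpi_linear X).
Definition kproj : khom M kquot.
Proof.
refine (@KHom gT k M kquot (fun X => @kqpi X : {linear M X -> kquot X}) _ _).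
- by move=> X Y f m; rewrite /= kq_resE.
- by move=> X Y f m; rewrite /= kq_trE.
Defined.

Lemma kproj_surj : ksurjective kproj.
Proof. by move=> X u; have [x ->] := kqpi_surj u; exists x. Qed.
Lemma kproj_eq0 X (m : M X) : kproj X m = 0 <-> R X m.
Proof. by rewrite -[0](raddf0 (kproj X)) kq_eqP subr0. Qed.

End Quotient.

(** * Morphisms, kernels and images *)

Section Homs.
Variables (M N : kmod k).

Definition khom_id : khom M M :=
  @KHom gT k M M (fun X => idfun : {linear M X -> M X})
    (fun _ _ _ _ => erefl) (fun _ _ _ _ => erefl).

Definition khom_zero : khom M N.
Proof.
refine (@KHom gT k M N (fun X => \0 : {linear M X -> N X}) _ _) => X Y f m /=.
  by rewrite raddf0.
by rewrite raddf0.
Defined.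

Definition khom_comp (L : kmod k) (g : khom M N) (f : khom L M) : khom L N.
Proof.
refine (@KHom gT k L N (fun X => g X \o f X : {linear L X -> N X}) _ _)
  => X Y h m /=.
  by rewrite !hval_res.
by rewrite !hval_tr.
Defined.

Definition khom_sub (f g : khom M N) : khom M N.
Proof.
refine (@KHom gT k M N (fun X => f X \- g X : {linear M X -> N X}) _ _)
  => X Y h m /=.
  by rewrite !hval_res raddfB.
by rewrite !hval_tr raddfB.
Defined.

Definition kker (f : khom M N) : ksub M.
Proof.
refine (@KSub M (fun X m => f X m = 0) _ _ _ _).
- by move=> X; rewrite raddf0.
- by move=> X a x y fx fy; rewrite linearP fx fy scaler0 addr0.
- by move=> X Y h m fm; rewrite hval_res fm raddf0.
- by move=> X Y h m fm; rewrite hval_tr fm raddf0.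
Defined.

Definition kim (f : khom M N) : ksub N.
Proof.
refine (@KSub N (fun X n => exists m, f X m = n) _ _ _ _).
- by move=> X; exists 0; rewrite raddf0.
- by move=> X a _ _ [x <-] [y <-]; exists (a *: x + y); rewrite linearP.
- by move=> X Y h _ [m <-]; exists (mres M h m); rewrite hval_res.
- by move=> X Y h _ [m <-]; exists (mtr M h m); rewrite hval_tr.
Defined.
End Homs.

Definition ksub_add (M : kmod k) (R S : ksub M) : ksub M.
Proof.
refine (@KSub M (fun X m => exists x y, [/\ R X x, S X y & m = x + y]) _ _ _ _).
- by move=> X; exists 0, 0; split; [apply: kin0|apply: kin0|rewrite addr0].
- move=> X a _ _ [x [y [Rx Sy ->]]] [x' [y' [Rx' Sy' ->]]].
  exists (a *: x + x'), (a *: y + y'); split; try exact: kinP.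
  by rewrite scalerDr addrACA.
- move=> X Y h _ [x [y [Rx Sy ->]]]; exists (mres M h x), (mres M h y).
  by split; try exact: kin_res; rewrite raddfD.
- move=> X Y h _ [x [y [Rx Sy ->]]]; exists (mtr M h x), (mtr M h y).
  by split; try exact: kin_tr; rewrite raddfD.
Defined.

Lemma injective_ker0 (M N : kmod k) (f : khom M N) X :
  (forall m, f X m = 0 -> m = 0) -> injective (f X).
Proof.
move=> f0 x y fxy; apply/subr0_eq/f0; rewrite raddfB.
by apply/eqP; rewrite subr_eq0; apply/eqP.
Qed.

End Submodules.

(** * The modules M(X * -) *)

Section Shift.
Variables (gT : finGroupType) (k : cgreen gT).
Implicit Types X Y Z : gset gT.

Definition kreg : kmod k.
Proof.
refine (@KMod gT k (fun X => (k X)^o)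
  (fun X Y f => gres k f : {additive (k Y)^o -> (k X)^o})
  (fun X Y f => gtr k f : {additive (k X)^o -> (k Y)^o})
  (green_mackey k) _ _ _).
- by move=> X Y f a b; rewrite /GRing.scale /= rmorphM.
- by move=> X Y f a b; rewrite /GRing.scale /= green_frobenius.
- by move=> X Y f a b; rewrite /GRing.scale /= mulrC green_frobenius mulrC.
Defined.

Section ShiftOne.
Variables (M : kmod k) (X : gset gT).

(** A separate type for M(X * Z), so that it carries a k(Z)-module structure alongside its own
    structure over k(X * Z). *)
Definition shift_val (Z : gset gT) : Type := M (gprod X Z).
HB.instance Definition _ Z := GRing.Zmodule.on (shift_val Z).
Definition shift_scale Z (a : k Z) (m : shift_val Z) : shift_val Z :=
  gres k (gsnd X Z) a *: (m : M (gprod X Z)).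
Lemma shift_scaleA Z a b (m : shift_val Z) :
  shift_scale a (shift_scale b m) = shift_scale (a * b) m.
Proof. by rewrite /shift_scale scalerA rmorphM. Qed.
Lemma shift_scale1 Z : left_id 1 (@shift_scale Z).
Proof. by move=> m; rewrite /shift_scale rmorph1 scale1r. Qed.
Lemma shift_scaleDr Z : right_distributive (@shift_scale Z) +%R.
Proof. by move=> a m n; apply: scalerDr. Qed.
Lemma shift_scaleDl Z (m : shift_val Z) :
  {morph (@shift_scale Z)^~ m : a b / a + b}.
Proof. by move=> a b; rewrite /shift_scale rmorphD; apply: scalerDl. Qed.
HB.instance Definition _ Z := GRing.Zmodule_isLmodule.Build (k Z) (shift_val Z)
  (@shift_scaleA Z) (@shift_scale1 Z) (@shift_scaleDr Z) (@shift_scaleDl Z).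

Definition shift_map Y Z (f : gmap Y Z) : gmap (gprod X Y) (gprod X Z) :=
  gtimes (gid X) f.
Definition shift_res Y Z (f : gmap Y Z) :
    {additive shift_val Z -> shift_val Y} := mres M (shift_map f).
Definition shift_tr Y Z (f : gmap Y Z) :
    {additive shift_val Y -> shift_val Z} := mtr M (shift_map f).

Lemma shift_map_id Y : shift_map (gid Y) = gid (gprod X Y).
Proof. by apply: gmap_eq => -[]. Qed.
Lemma shift_map_comp Y Z W (h : gmap Z W) (f : gmap Y Z) :
  shift_map (gcomp h f) = gcomp (shift_map h) (shift_map f).
Proof. exact: gmap_eq. Qed.
Lemma shift_pullback W Y1 Y2 Z (f : gmap Y1 Z) (h : gmap Y2 Z)
    (f' : gmap W Y2) (h' : gmap W Y1) : is_pullback f h f' h' ->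
  is_pullback (shift_map f) (shift_map h) (shift_map f') (shift_map h').
Proof.
case=> comm lift; split=> [[x w]|[x y] [x' y']] /=; first by rewrite comm.
case=> <- fy; have [w [[h'w f'w] uw]] := lift _ _ fy.
exists (x, w); split=> [|[x1 w1] /= [[-> h'1] [f'1]]]; first by rewrite h'w f'w.
by rewrite (uw w1).
Qed.
Lemma shift_coproduct Y1 Y2 Z (i : gmap Y1 Z) (j : gmap Y2 Z) :
  is_coproduct i j -> is_coproduct (shift_map i) (shift_map j).
Proof.
case=> s sK Ks.
exists (fun p : X * Z => match s p.2 with
  inl y => inl (p.1, y) | inr y => inr (p.1, y) end).
  case=> [[x y]|[x y]] /=.
    by rewrite (sK (inl y)).
  by rewrite (sK (inr y)).
by move=> [x z] /=; have := Ks z; case: (s z) => y <-.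
Qed.

Lemma shift_mackey :
  @is_mackey gT shift_val (fun _ _ f => shift_res f) (fun _ _ f => shift_tr f).
Proof.
split.
- by move=> Y m; rewrite /shift_res shift_map_id mres_id.
- by move=> Y Z W h f m; rewrite /shift_res shift_map_comp -mres_comp.
- by move=> Y m; rewrite /shift_tr shift_map_id mtr_id.
- by move=> Y Z W h f m; rewrite /shift_tr shift_map_comp -mtr_comp.
- move=> W Y1 Y2 Z f h f' h' pb m.
  exact: (mtr_pullback _ (shift_pullback pb)).
- move=> Y1 Y2 Z i j ij a b.
  exact: (mackey_add (kmod_mackey M) (shift_coproduct ij)).
Qed.

Lemma gres_snd Y Z (f : gmap Y Z) (a : k Z) :
  gres k (gsnd X Y) (gres k f a) = gres k (shift_map f) (gres k (gsnd X Z) a).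
Proof. by rewrite !gres_comp; congr (gres k _ _); apply: gmap_eq. Qed.

Lemma gsnd_pullback Y Z (f : gmap Y Z) :
  is_pullback f (gsnd X Z) (shift_map f) (gsnd X Y).
Proof.
split=> [[x y]|y [x z] /= <-] //=; exists (x, y); split=> //.
by move=> [x' y'] /= [-> [->]].
Qed.

Lemma gtr_snd Y Z (f : gmap Y Z) (a : k Y) :
  gres k (gsnd X Z) (gtr k f a) = gtr k (shift_map f) (gres k (gsnd X Y) a).
Proof.
exact: (mackey_pullback (green_mackey k) (gsnd_pullback f)).
Qed.

Definition shift : kmod k.
Proof.
refine (@KMod gT k shift_val (fun _ _ f => shift_res f)
  (fun _ _ f => shift_tr f) shift_mackey _ _ _).
- move=> Y Z f a m; rewrite /shift_res /GRing.scale /= /shift_scale mresZ.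
  by rewrite gres_snd.
- move=> Y Z f a m; rewrite /shift_res /shift_tr /GRing.scale /= /shift_scale.
  by rewrite mtr_frobl gtr_snd.
- move=> Y Z f a m; rewrite /shift_tr /GRing.scale /= /shift_scale.
  by rewrite gres_snd mtr_frobr.
Defined.

Lemma shiftZ Z (a : k Z) (m : shift Z) :
  a *: m = gres k (gsnd X Z) a *: (m : M (gprod X Z)).
Proof. by []. Qed.
Lemma shift_resE Y Z (f : gmap Y Z) m : mres shift f m = mres M (shift_map f) m.
Proof. by []. Qed.
Lemma shift_trE Y Z (f : gmap Y Z) m : mtr shift f m = mtr M (shift_map f) m.
Proof. by []. Qed.
End ShiftOne.

(** * Functoriality of M(X * -) in the G-set X *)

Section ShiftArg.
Variables (M : kmod k) (X X' : gset gT) (f : gmap X X').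

Definition arg_map Z : gmap (gprod X Z) (gprod X' Z) := gtimes f (gid Z).
Definition arg_res_fun Z (m : shift M X' Z) : shift M X Z :=
  mres M (arg_map Z) m.
Definition arg_tr_fun Z (m : shift M X Z) : shift M X' Z :=
  mtr M (arg_map Z) m.
Lemma gres_arg Z (a : k Z) :
  gres k (gsnd X Z) a = gres k (arg_map Z) (gres k (gsnd X' Z) a).
Proof. by rewrite !gres_comp; congr (gres k _ _); apply: gmap_eq. Qed.
Lemma arg_res_linear Z : linear (@arg_res_fun Z).
Proof.
move=> a x y; rewrite /arg_res_fun shiftZ raddfD; congr (_ + _).
by rewrite mresZ shiftZ gres_arg.
Qed.
Lemma arg_tr_linear Z : linear (@arg_tr_fun Z).
Proof.
move=> a x y; rewrite /arg_tr_fun shiftZ raddfD; congr (_ + _).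
by rewrite gres_arg mtr_frobr shiftZ.
Qed.
HB.instance Definition _ Z := GRing.isLinear.Build (k Z) (shift M X' Z)
  (shift M X Z) _ (@arg_res_fun Z) (@arg_res_linear Z).
HB.instance Definition _ Z := GRing.isLinear.Build (k Z) (shift M X Z)
  (shift M X' Z) _ (@arg_tr_fun Z) (@arg_tr_linear Z).

Lemma arg_shift_comp Y Z (h : gmap Y Z) :
  gcomp (arg_map Z) (shift_map X h) = gcomp (shift_map X' h) (arg_map Y).
Proof. exact: gmap_eq. Qed.

Lemma arg_pullback Y Z (h : gmap Y Z) :
  is_pullback (arg_map Z) (shift_map X' h) (arg_map Y) (shift_map X h).
Proof.
split=> [[x y]|[x z] [x' y]] //= [<- ->]; exists (x, y); split=> //.
by move=> [x1 y1] /= [[-> _] [->]].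
Qed.
Lemma arg_pullback' Y Z (h : gmap Y Z) :
  is_pullback (shift_map X' h) (arg_map Z) (shift_map X h) (arg_map Y).
Proof.
split=> [[x y]|[x' y] [x z]] //= [-> <-]; exists (x, y); split=> //.
by move=> [x1 y1] /= [[_ ->] [->]].
Qed.

Definition arg_res : khom (shift M X') (shift M X).
Proof.
refine (@KHom gT k (shift M X') (shift M X)
  (fun Z => @arg_res_fun Z : {linear _ -> _}) _ _) => Y Z h m /=.
  by rewrite /arg_res_fun !shift_resE !mres_comp arg_shift_comp.
by rewrite /arg_res_fun !shift_trE (mtr_pullback _ (arg_pullback' h)).
Defined.
Definition arg_tr : khom (shift M X) (shift M X').
Proof.
refine (@KHom gT k (shift M X) (shift M X')
  (fun Z => @arg_tr_fun Z : {linear _ -> _}) _ _) => Y Z h m /=.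
  by rewrite /arg_tr_fun !shift_resE (mtr_pullback _ (arg_pullback h)).
by rewrite /arg_tr_fun !shift_trE !mtr_comp arg_shift_comp.
Defined.

Lemma arg_resE Z m : arg_res Z m = mres M (arg_map Z) m. Proof. by []. Qed.
Lemma arg_trE Z m : arg_tr Z m = mtr M (arg_map Z) m. Proof. by []. Qed.
End ShiftArg.

Section ShiftHom.
Variables (M N : kmod k) (f : khom M N) (X : gset gT).
Definition shift_hom_fun Z (m : shift M X Z) : shift N X Z := f (gprod X Z) m.
Lemma shift_hom_linear Z : linear (@shift_hom_fun Z).
Proof. by move=> a x y; rewrite /shift_hom_fun shiftZ linearP. Qed.
HB.instance Definition _ Z := GRing.isLinear.Build (k Z) (shift M X Z)
  (shift N X Z) _ (@shift_hom_fun Z) (@shift_hom_linear Z).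
Definition shift_hom : khom (shift M X) (shift N X).
Proof.
refine (@KHom gT k (shift M X) (shift N X)
  (fun Z => @shift_hom_fun Z : {linear _ -> _}) _ _) => Y Z h m /=.
  by rewrite /shift_hom_fun shift_resE hval_res.
by rewrite /shift_hom_fun shift_trE hval_tr.
Defined.
End ShiftHom.

Lemma shift_exact (L M N : kmod k) (f : khom L M) (g : khom M N) X :
  short_exact f g -> short_exact (shift_hom f X) (shift_hom g X).
Proof.
case=> inj_f ker_g surj_g; split=> [Z|Z m|Z n].
- exact: inj_f.
- exact: ker_g.
- exact: surj_g.
Qed.

End Shift.

(** * The free modules k_X and box products with them *)

Section FreeModules.
Variables (gT : finGroupType) (k : cgreen gT).
Implicit Types X Y Z : gset gT.
Implicit Types M N P Q : kmod k.

Definition kfreeon X : kmod k := shift (kreg k) X.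

Lemma kreg_scale1 X (a : k X) : a *: (1 : (k X)^o) = a.
Proof. exact: mulr1. Qed.

Section Theta.
Variables (M : kmod k) (X : gset gT).

Definition theta_fun Z (m : M Z) (a : kfreeon X Z) : shift M X Z :=
  (a : k (gprod X Z)) *: mres M (gsnd X Z) m.

Lemma gsnd_shift Y Z (f : gmap Y Z) (m : M Z) :
  mres M (gsnd X Y) (mres M f m) = mres M (shift_map X f) (mres M (gsnd X Z) m).
Proof. by rewrite !mres_comp; congr (mres M _ _); apply: gmap_eq. Qed.

(* Exhibits M(X * -) as the box product of M and k_X. *)
Definition theta : pairing M (kfreeon X) (shift M X).
Proof.
refine (@Pairing gT k M (kfreeon X) (shift M X) theta_fun _ _ _ _ _ _ _).
- by move=> Z m m' a; rewrite /theta_fun raddfD scalerDr.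
- by move=> Z m a a'; rewrite /theta_fun scalerDl.
- move=> Z c m a; rewrite /theta_fun shiftZ mresZ !scalerA mulrC //.
- by move=> Z c m a; rewrite /theta_fun !shiftZ scalerA.
- move=> Y Z f m a; rewrite /theta_fun shift_resE mresZ gsnd_shift //.
- move=> Y Z f m a; rewrite /theta_fun shift_trE mtr_frobr.
  by rewrite -(mtr_pullback _ (gsnd_pullback X f)).
- move=> Y Z f m a; rewrite /theta_fun shift_trE gsnd_shift mtr_frobl //.
Defined.

Lemma thetaE Z (m : M Z) a :
  theta Z m a = (a : k (gprod X Z)) *: mres M (gsnd X Z) m.
Proof. by []. Qed.

Definition graph_map Z : gmap (gprod X Z) (gprod X (gprod X Z)) :=
  gpair (gfst X Z) (gid (gprod X Z)).
Lemma gsnd_graph Z : gcomp (gsnd X (gprod X Z)) (graph_map Z) = gid _.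
Proof. by apply: gmap_eq => -[]. Qed.
Lemma shift_gsnd_graph Z :
  gcomp (shift_map X (gsnd X Z)) (graph_map Z) = gid _.
Proof. by apply: gmap_eq => -[]. Qed.

(* The restriction along X * Z -> X of the universal element of k_X(X). *)
Definition univ Z : kfreeon X (gprod X Z) := gtr k (graph_map Z) 1.

(** The Frobenius relation collapses the transfer along the graph. Every element of M(X * Z) is thus
    a transfer of a value of [theta], so a map out of M(X * -) is determined by its values on
    pairings. *)
Lemma theta_univ Z (m : M (gprod X Z)) :
  mtr (shift M X) (gsnd X Z) (theta _ m (univ Z)) = m.
Proof.
rewrite thetaE /univ shift_trE -mtr_frobl scale1r mtr_comp mres_comp.
rewrite gsnd_graph.
rewrite shift_gsnd_graph.
by rewrite mres_id mtr_id.
Qed.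

Lemma univ_res Y Z (f : gmap Y Z) :
  mres (kfreeon X) (shift_map X f) (univ Z) = univ Y.
Proof.
have pb : is_pullback (graph_map Z) (shift_map X (shift_map X f))
    (graph_map Y) (shift_map X f).
  split=> [[x y]|[x z] [x1 [x2 y]]] //= [<- <- ->]; exists (x, y); split=> //.
  by move=> [x3 y3] /= [[-> _] [->]].
rewrite /univ shift_resE.
apply: etrans (mackey_pullback (green_mackey k) pb _) _.
by rewrite rmorph1.
Qed.

(** Counterpart of [theta_univ] for k itself: it rebuilds any second argument of a pairing from the
    universal element. *)
Lemma univ_scale Z (a : k (gprod X Z)) :
  mtr (kfreeon X) (gsnd X Z) (a *: univ Z) = a.
Proof.
rewrite shift_trE shiftZ /univ.
rewrite -[gtr _ _ _]/(mtr (kreg k) _ _) -mtr_frobr.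
rewrite kreg_scale1 gres_comp.
rewrite gsnd_graph.
rewrite gres_id [LHS]mtr_comp.
rewrite shift_gsnd_graph.
by rewrite mtr_id.
Qed.

Section Induced.
Variables (Q : kmod k) (eta : pairing M (kfreeon X) Q).
Definition theta_ind_fun Z (m : shift M X Z) : Q Z :=
  mtr Q (gsnd X Z) (eta (gprod X Z) m (univ Z)).
Lemma theta_ind_linear Z : linear (@theta_ind_fun Z).
Proof.
move=> a x y; rewrite /theta_ind_fun shiftZ pairDl pairZl raddfD /=.
by rewrite mtr_frobr.
Qed.
HB.instance Definition _ Z := GRing.isLinear.Build (k Z) (shift M X Z) (Q Z) _
  (@theta_ind_fun Z) (@theta_ind_linear Z).
Definition theta_ind : khom (shift M X) Q.
Proof.
refine (@KHom gT k (shift M X) Q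
  (fun Z => @theta_ind_fun Z : {linear _ -> _}) _ _) => Y Z f m /=.
  rewrite /theta_ind_fun shift_resE.
  have pb : is_pullback (gsnd X Z) f (gsnd X Y) (shift_map X f).
    split=> [[x y]|[x z] y /= ->] //; exists (x, y); split=> //.
    by move=> [x1 y1] /= [[-> _] ->].
  by rewrite (mtr_pullback _ pb) pair_res univ_res.
rewrite /theta_ind_fun shift_trE -(univ_res f) -pair_frobl.
rewrite !mtr_comp; congr (mtr Q _ _).
exact: gmap_eq.
Defined.
End Induced.

Lemma theta_relbox : is_relbox theta.
Proof.
move=> Q eta; exists (theta_ind eta) => [Z m a|psi psiE Z m].
  (* The scalar a moves across the pairing, and Frobenius reciprocity moves the transfer to the
     second argument, where it turns a times the universal element back into a. *)
  rewrite /= /theta_ind_fun /theta_fun pairZl -pairZr.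
  by rewrite pair_frobr univ_scale.
by rewrite /= /theta_ind_fun -psiE -hval_tr theta_univ.
Qed.

End Theta.

Section Universal.
Variables (X : gset gT) (N : kmod k) (n : N X).

(** The Yoneda map of n: an element a of k(X * Z) acts as the span X <- X * Z -> Z weighted by a. *)
Definition free_ind_fun Z (a : kfreeon X Z) : N Z :=
  mtr N (gsnd X Z) ((a : k (gprod X Z)) *: mres N (gfst X Z) n).
Lemma free_ind_linear Z : linear (@free_ind_fun Z).
Proof.
move=> c x y; rewrite /free_ind_fun shiftZ scalerDl raddfD /=.
by congr (_ + _); rewrite -scalerA mtr_frobr.
Qed.
HB.instance Definition _ Z := GRing.isLinear.Build (k Z) (kfreeon X Z) (N Z) _
  (@free_ind_fun Z) (@free_ind_linear Z).
Definition free_ind : khom (kfreeon X) N.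
Proof.
refine (@KHom gT k (kfreeon X) N
  (fun Z => @free_ind_fun Z : {linear _ -> _}) _ _) => Y Z f m.
  change (free_ind_fun (mres (kfreeon X) f m) = mres N f (free_ind_fun m)).
  rewrite /free_ind_fun shift_resE.
  have pb : is_pullback (gsnd X Z) f (gsnd X Y) (shift_map X f).
    split=> [[x y]|[x z] y /= ->] //; exists (x, y); split=> //.
    by move=> [x1 y1] /= [[-> _] ->].
  rewrite (mtr_pullback _ pb) mresZ mres_comp.
  congr (mtr N _ (_ *: mres N _ _)).
  exact: gmap_eq.
change (free_ind_fun (mtr (kfreeon X) f m) = mtr N f (free_ind_fun m)).
rewrite /free_ind_fun shift_trE.
have -> : gfst X Y = gcomp (gfst X Z) (shift_map X f) by apply: gmap_eq.
rewrite -mres_comp -mtr_frobl !mtr_comp; congr (mtr N _ _).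
  exact: gmap_eq.
Defined.

Lemma free_indE Z (a : kfreeon X Z) :
  free_ind Z a = mtr N (gsnd X Z) ((a : k (gprod X Z)) *: mres N (gfst X Z) n).
Proof. by []. Qed.
End Universal.

End FreeModules.

(** * Flat modules *)

Section Flatness.
Variables (gT : finGroupType) (k : cgreen gT).
Implicit Types X Y Z : gset gT.
Implicit Types M N P Q : kmod k.

Lemma khom_compE L M N (g : khom M N) (f : khom L M) X x :
  khom_comp g f X x = g X (f X x).
Proof. by []. Qed.

Section Inverse.
Variables (M N : kmod k) (f : khom M N).
Hypotheses (inj_f : forall X, injective (f X)) (surj_f : ksurjective f).
Definition khom_inv_fun X (n : N X) : M X := sval (cid (surj_f n)).
Lemma khom_inv_funK X (n : N X) : f X (khom_inv_fun n) = n.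
Proof. exact: svalP (cid (surj_f n)). Qed.
Lemma khom_inv_linear X : linear (@khom_inv_fun X).
Proof. by move=> a x y; apply: inj_f; rewrite linearP !khom_inv_funK. Qed.
HB.instance Definition _ X := GRing.isLinear.Build (k X) (N X) (M X) _
  (@khom_inv_fun X) (@khom_inv_linear X).
Definition khom_inv : khom N M.
Proof.
refine (@KHom gT k N M (fun X => @khom_inv_fun X : {linear _ -> _}) _ _)
  => X Y h n; apply: inj_f.
  by rewrite hval_res !khom_inv_funK.
by rewrite hval_tr !khom_inv_funK.
Defined.
Lemma khom_invK X n : f X (khom_inv X n) = n.
Proof. exact: khom_inv_funK. Qed.
Lemma khom_Kinv X m : khom_inv X (f X m) = m.
Proof. by apply: inj_f; rewrite khom_invK. Qed.
End Inverse.

Section FreeOn.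
Variables (X : gset gT).
Definition diag_map : gmap X (gprod X X) := gpair (gid X) (gid X).
Definition free_gen : kfreeon k X X := gtr k diag_map 1.

Lemma free_ind_gen N (n : N X) : free_ind n X free_gen = n.
Proof.
rewrite free_indE -mtr_frobl scale1r mtr_comp mres_comp.
have -> : gcomp (gfst X X) diag_map = gid X by apply: gmap_eq.
have -> : gcomp (gsnd X X) diag_map = gid X by apply: gmap_eq.
by rewrite mres_id mtr_id.
Qed.

Lemma khom_free_ind M N (m : M X) (psi : khom M N) Z a :
  psi Z (free_ind m Z a) = free_ind (psi X m) Z a.
Proof. by rewrite !free_indE hval_tr linearZ hval_res. Qed.

(** The map sending v to n is the inverse followed by the Yoneda map of n; it is unique because
    every element of M has the form [free_ind v Z a]. *)
Lemma free_on_iso M (v : M X) : (forall Z, injective (free_ind v Z)) ->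
  ksurjective (free_ind v) -> free_on v.
Proof.
move=> inj_v surj_v N n.
exists (khom_comp (free_ind n) (khom_inv inj_v surj_v)).
  change (free_ind n X (khom_inv inj_v surj_v X v) = n).
  have -> : khom_inv inj_v surj_v X v = free_gen.
    by apply: (inj_v X); rewrite khom_invK free_ind_gen.
  exact: free_ind_gen.
move=> psi psi_v Z m; have [a <-] := surj_v Z m.
rewrite khom_free_ind psi_v; congr (free_ind n Z _).
by rewrite khom_Kinv.
Qed.
End FreeOn.

Lemma free_on_kfree M X (v : M X) : free_on v -> kfree M.
Proof.
move=> free_v; exists unit, (fun=> M), (fun=> khom_id M).
split=> [_|N f]; first by exists X, v.
by exists (f tt) => [[]|psi E Z m] //; apply: (E tt).
Qed.

(** Each summand lifts by lifting the image of its generator; the lifts assemble on the direct sum,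
    and uniqueness in the universal properties identifies the composites. *)
Lemma kfree_projective M : kfree M -> kprojective M.
Proof.
case=> I [P [inj [freeP sumM]]] N N' e f surj_e.
have lift i : exists g : khom (P i) N,
    forall X x, e X (g X x) = f X (inj i X x).
  have [X [u free_u]] := freeP i.
  have [n en] := surj_e X (f X (inj i X u)).
  have [g gu _] := free_u N n; exists g => Z x.
  have [h _ uh] := free_u N' (f X (inj i X u)).
  have -> : f Z (inj i Z x) = h Z x by apply: (uh (khom_comp f (inj i))).
  by apply: (uh (khom_comp e g)); rewrite /= gu.
pose g i := sval (cid (lift i)).
have gE i X x : e X (g i X x) = f X (inj i X x).
  exact: svalP (cid (lift i)) X x.
have [h hE _] := sumM N g; exists h => X m.
have [h' _ uh'] := sumM N' (fun i => khom_comp f (inj i)).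
rewrite (uh' f) //; apply: (uh' (khom_comp e h)) => i Z x /=.
by rewrite hE gE.
Qed.

Definition pairing_map M N M' N' P Q (s : khom M M') (f : khom N N')
  (g : khom P Q) (t : pairing M' N' P) : pairing M N Q.
Proof.
refine (@Pairing gT k M N Q (fun X m n => g X (t X (s X m) (f X n)))
  _ _ _ _ _ _ _).
- by move=> X m m' n; rewrite raddfD pairDl raddfD.
- by move=> X m n n'; rewrite raddfD pairDr raddfD.
- by move=> X a m n; rewrite linearZ pairZl linearZ.
- by move=> X a m n; rewrite linearZ pairZr linearZ.
- by move=> X Y h m n; rewrite -hval_res pair_res !hval_res.
- by move=> X Y h m n; rewrite -hval_tr !hval_res pair_frobl hval_tr.
- by move=> X Y h m n; rewrite -hval_tr !hval_res pair_frobr hval_tr.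
Defined.

Definition pairing_swap M N P (t : pairing M N P) : pairing N M P.
Proof.
refine (@Pairing gT k N M P (fun X n m => t X m n) _ _ _ _ _ _ _).
- by move=> X n n' m; rewrite pairDr.
- by move=> X n m m'; rewrite pairDl.
- by move=> X a n m; rewrite pairZr.
- by move=> X a n m; rewrite pairZl.
- by move=> X Y h n m; rewrite pair_res.
- by move=> X Y h n m; rewrite pair_frobr.
- by move=> X Y h n m; rewrite pair_frobl.
Defined.

Lemma relbox_swap M N P (t : pairing M N P) :
  is_relbox t -> is_relbox (pairing_swap t).
Proof.
move=> boxt Q eta; have [phi phiE uphi] := boxt Q (pairing_swap eta).
exists phi => [X n m|psi psiE]; first by rewrite /= phiE.
by apply: uphi => X m n; rewrite /= -psiE.
Qed.

Lemma relbox_ext M N P Q (t : pairing M N P) (phi psi : khom P Q) :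
  is_relbox t -> (forall X m n, phi X (t X m n) = psi X (t X m n)) ->
  forall X x, phi X x = psi X x.
Proof.
move=> boxt E X x.
have [h _ uh] := boxt Q (pairing_map (khom_id M) (khom_id N) phi t).
by rewrite (uh phi) // (uh psi) // => Z m n; rewrite /= E.
Qed.

Lemma relbox_functorial M N M' N' P P' (t : pairing M N P)
    (t' : pairing M' N' P')
    (s : khom M M') (f : khom N N') : is_relbox t ->
  exists u : khom P P', forall X m n, u X (t X m n) = t' X (s X m) (f X n).
Proof.
move=> boxt; have [u uE _] := boxt P' (pairing_map s f (khom_id P') t').
by exists u.
Qed.

Lemma ker_im_exact M N (f : khom M N) (R : ksub N)
    (fR : forall X m, R X (f X m)) :
  (forall X n, R X n -> exists m, f X m = n) ->
  short_exact (ksub_incl (kker f)) (ksub_lift fR).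
Proof.
move=> Rf; split=> [X|X m|X n].
- exact: ksub_val_inj.
- split=> [/(congr1 (@ksub_elt _ _ _ _ _)) /= fm0|[[l lK] <-]].
    by exists (@ksub_mk _ _ _ (kker f) X m fm0).
  by apply: ksub_val_inj; exact: (@ksub_valP _ _ _ (kker f) X (KSubVal lK)).
- by have [m fm] := Rf _ _ (ksub_valP n); exists m; apply: ksub_val_inj.
Qed.

Lemma quot_exact M (R : ksub M) : short_exact (ksub_incl R) (kproj R).
Proof.
split=> [X|X m|]; last exact: kproj_surj.
  exact: ksub_val_inj.
rewrite kproj_eq0; split=> [Rm|[l <-]]; last exact: ksub_valP.
by exists (ksub_mk Rm).
Qed.

(* With J the image of beta, flatness makes M (x) J -> M (x) C injective and
   M (x) ker beta -> M (x) B -> M (x) J exact. *)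
Lemma flat_ker M B C (beta : khom B C) PB PC (tB : pairing M B PB)
    (tC : pairing M C PC) (b : khom PB PC) (R : ksub PB) :
  kflat M -> is_relbox tB -> is_relbox tC -> is_relbox_map tB tC beta b ->
  (forall X m x, beta X x = 0 -> R X (tB X m x)) ->
  forall X w, b X w = 0 -> R X w.
Proof.
move=> flatM boxB boxC bE Rker X w bw0.
have imP Z x : kim beta Z (beta Z x) by exists x.
pose j := ksub_lift imP.
have exK : short_exact (ksub_incl (kker beta)) j by apply: ker_im_exact.
have exJ := quot_exact (kim beta).
have [PK [tK boxK]] := relbox_exists M (ksub_kmod (kker beta)).
have [PJ [tJ boxJ]] := relbox_exists M (ksub_kmod (kim beta)).
have [PL [tL boxL]] := relbox_exists M (kquot (kim beta)).
have [a aE] := relbox_functorial tB (khom_id M) (ksub_incl (kker beta)) boxK.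
have [b1 b1E] := relbox_functorial tJ (khom_id M) j boxB.
have [b2 b2E] := relbox_functorial tC (khom_id M) (ksub_incl (kim beta)) boxJ.
have [c cE] := relbox_functorial tL (khom_id M) (kproj (kim beta)) boxC.
have [_ exB _] := flatM _ _ _ _ _ exK _ _ _ _ _ _ boxK boxB boxJ _ _ aE b1E.
have [inj2 _ _] := flatM _ _ _ _ _ exJ _ _ _ _ _ _ boxJ boxC boxL _ _ b2E cE.
have b12 : b2 X (b1 X w) = b X w.
  apply: (relbox_ext (phi := khom_comp b2 b1) boxB) => Z m x.
  by rewrite /= b1E b2E bE.
have b1w : b1 X w = 0 by apply: inj2; rewrite b12 bw0 raddf0.
(* By exactness w comes from M (x) ker beta, where vanishing of the composite to the quotient by R
   can be tested on pairings. *)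
have [l <-] := (exB X w).1 b1w; apply/kproj_eq0.
have -> : 0 = khom_zero PK (kquot R) X l by [].
apply: (relbox_ext (phi := khom_comp (kproj R) a) boxK) => Z m x.
by rewrite /= -/(kproj R Z _) aE; apply/kproj_eq0/Rker/(ksub_valP x).
Qed.

(** M (x) N is a retract of k_X (x) N = N(X * -), naturally in N, and N |-> N(X * -) is exact
    levelwise; exactness passes to retracts by a diagram chase. *)
Lemma retract_flat M X (s : khom M (kfreeon k X)) (q : khom (kfreeon k X) M) :
  (forall Z m, q Z (s Z m) = m) -> kflat M.
Proof.
move=> qs N1 N2 N3 f g exfg P1 P2 P3 t1 t2 t3 box1 box2 box3 u v uE vE.
pose T N := pairing_swap (theta N X).
have boxT N : is_relbox (T N) by apply/relbox_swap/theta_relbox.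
have [fX_inj gX_ker gX_surj] := shift_exact X exfg.
have [S1 S1E] := relbox_functorial (T N1) s (khom_id N1) box1.
have [S2 S2E] := relbox_functorial (T N2) s (khom_id N2) box2.
have [S3 S3E] := relbox_functorial (T N3) s (khom_id N3) box3.
have [Q1 Q1E] := relbox_functorial t1 q (khom_id N1) (boxT N1).
have [Q2 Q2E] := relbox_functorial t2 q (khom_id N2) (boxT N2).
have [Q3 Q3E] := relbox_functorial t3 q (khom_id N3) (boxT N3).
have TE N N' (h : khom N N') Z a n :
    shift_hom h X Z (T N Z a n) = T N' Z a (h Z n).
  by rewrite /= /shift_hom_fun /theta_fun linearZ hval_res.
have S2u Z l : S2 Z (u Z l) = shift_hom f X Z (S1 Z l).
  apply: (relbox_ext (phi := khom_comp S2 u)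
    (psi := khom_comp (shift_hom f X) S1) box1) => Y m n.
  by rewrite !khom_compE uE S2E S1E TE.
have S3v Z l : S3 Z (v Z l) = shift_hom g X Z (S2 Z l).
  apply: (relbox_ext (phi := khom_comp S3 v)
    (psi := khom_comp (shift_hom g X) S2) box2) => Y m n.
  by rewrite !khom_compE vE S3E S2E TE.
have uQ1 Z l : u Z (Q1 Z l) = Q2 Z (shift_hom f X Z l).
  apply: (relbox_ext (phi := khom_comp u Q1)
    (psi := khom_comp Q2 (shift_hom f X)) (boxT N1)) => Y m n.
  by rewrite !khom_compE Q1E uE TE Q2E.
have vQ2 Z l : v Z (Q2 Z l) = Q3 Z (shift_hom g X Z l).
  apply: (relbox_ext (phi := khom_comp v Q2)
    (psi := khom_comp Q3 (shift_hom g X)) (boxT N2)) => Y m n.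
  by rewrite !khom_compE Q2E vE TE Q3E.
have QS1 Z l : Q1 Z (S1 Z l) = l.
  apply: (relbox_ext (phi := khom_comp Q1 S1) (psi := khom_id P1) box1).
  move=> Y m n.
  by rewrite khom_compE S1E Q1E qs.
have QS2 Z l : Q2 Z (S2 Z l) = l.
  apply: (relbox_ext (phi := khom_comp Q2 S2) (psi := khom_id P2) box2).
  move=> Y m n.
  by rewrite khom_compE S2E Q2E qs.
have QS3 Z l : Q3 Z (S3 Z l) = l.
  apply: (relbox_ext (phi := khom_comp Q3 S3) (psi := khom_id P3) box3).
  move=> Y m n.
  by rewrite khom_compE S3E Q3E qs.
split=> [Z x y uxy|Z m|Z n].
- by rewrite -[x]QS1 -[y]QS1; congr (Q1 Z _); apply: fX_inj; rewrite -!S2u uxy.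
- split=> [vm0|[l <-]].
    have /gX_ker [t tE] : shift_hom g X Z (S2 Z m) = 0.
      by rewrite -S3v vm0 raddf0.
    by exists (Q1 Z t); rewrite uQ1 tE QS2.
  rewrite -[LHS]QS3 S3v S2u; apply: etrans (raddf0 (Q3 Z)).
  by congr (Q3 Z _); apply/gX_ker; exists (S1 Z l).
- have [t tE] := gX_surj Z (S3 Z n).
  by exists (Q2 Z t); rewrite vQ2 tE QS3.
Qed.

End Flatness.

(** * Groups of prime order *)

Section PrimeOrder.
Variables (gT : finGroupType) (p : nat).
Hypotheses (p_prime : prime p) (orderG : #|[set: gT]| = p).
Implicit Types X Y Z : gset gT.

Lemma order_prime (g : gT) : g != 1%g -> #[g]%g = p.
Proof.
move=> g1; have := order_dvdG (in_setT g); rewrite orderG.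
by move/(prime_nt_dvdP p_prime) => -> //; rewrite order_eq1.
Qed.

Lemma cycle_prime_order (g : gT) :
  g != 1%g -> forall h, exists i, h = (g ^+ i)%g.
Proof.
move=> g1 h; apply/cycleP; suff /eqP -> : <[g]>%g == [set: gT] by rewrite inE.
by rewrite eqEcard subsetT orderG -orderE order_prime /=.
Qed.

Lemma exists_generator : exists g : gT, g != 1%g.
Proof.
have : (1 < #|[set: gT]|)%N by rewrite orderG prime_gt1.
by rewrite cardG_gt1 => /trivgPn [g _ g1]; exists g.
Qed.

Lemma prime_mulgC (g h : gT) : (g * h = h * g)%g.
Proof.
have [->|g1] := eqVneq g 1%g; first by rewrite mulg1 mul1g.
by have [i ->] := cycle_prime_order g1 h; exact: commuteX.
Qed.

(** Two group elements with the same effect on x give a nontrivial element of the stabilizer, and it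
    generates G. *)
Lemma fixed_or_free X (x : X) :
  (forall g, gset_act X x g = x) \/ injective (orb x).
Proof.
have [fx|nfx] := pselect (forall g, gset_act X x g = x); [by left|right].
move=> g h /= E; apply: contrapT => /eqP gh; apply: nfx => h'.
have gh1 : ((g : gT) * (h : gT)^-1 != 1)%g by rewrite -eq_mulgV1.
have [i ->] := cycle_prime_order gh1 h'.
elim: i => [|i IHi]; first by rewrite expg0 act1.
by rewrite expgSr actM IHi actM E -actM mulgV act1.
Qed.

(** Induction step over orbits: removing the orbit of x, either a point or a copy of G, leaves a
    smaller G-set. *)
Lemma gset_split X (x : X) : exists Y (j : gmap Y X), (#|Y| < #|X|)%N /\
  ((exists fx, is_coproduct (@fixpt _ X x fx) j) \/ is_coproduct (orb x) j).
Proof.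
have lt_card A Y (i : gmap A X) (j : gmap Y X) :
    A -> is_coproduct i j -> (#|Y| < #|X|)%N.
  move=> a /bij_eq_card <-; rewrite card_sum -[X in (X < _)%N]add0n ltn_add2r.
  by apply/card_gt0P; exists a.
have [fx|free_x] := fixed_or_free x.
  have cop : is_coproduct (fixpt fx) (gcompl_map (fixpt fx)).
    by apply: gcompl_coproduct => -[] [].
  exists _, (gcompl_map (fixpt fx)).
  split; first exact: (lt_card gpt _ _ _ tt cop).
  by left; exists fx.
have cop := gcompl_coproduct free_x.
exists _, (gcompl_map (orb x)).
split; first exact: (lt_card greg _ _ _ 1%g cop).
by right.
Qed.

Variable k : cgreen gT.
Implicit Types M N : kmod k.

(** Inclusion of a restriction-stable family in a submodule is checked on the two transitive G-sets,
    since every element is the sum of the transfers of its restrictions to orbits. *)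
Lemma ksub_orbits N (K : forall X, N X -> Prop) (R : ksub N) :
  (forall X Y (f : gmap X Y) n, K Y n -> K X (mres N f n)) ->
  (forall n, K gpt n -> R gpt n) -> (forall n, K greg n -> R greg n) ->
  forall X n, K X n -> R X n.
Proof.
move=> Kres Kpt Kreg X; have [m] := ubnP #|X|; elim: m X => // m IHm X.
rewrite ltnS => leX n Kn.
have [X0|/card_gt0P [x _]] := posnP #|X|.
  by rewrite (kmod_card0 n X0); apply: kin0.
have [Y [j [ltY cop]]] := gset_split x.
have RY : R Y (mres N j n).
  by apply: IHm (Kres _ _ _ _ Kn); apply: leq_trans leX.
case: cop => [[fx cop]|cop]; rewrite (mackey_decomp n cop);
  by apply: kinD; apply: kin_tr => //; auto.
Qed.

Lemma orb_comp X Y (f : gmap X Y) x : gcomp f (orb x) = orb (f x).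
Proof. by apply: gmap_eq => h /=; rewrite gmap_equiv. Qed.

Lemma orb_lam X (x : X) h : gcomp (orb x) (lam h) = orb (gset_act X x h).
Proof. by apply: gmap_eq => h' /=; rewrite -actM. Qed.

(** A G-set X over G is free, with exactly one point over 1 in each orbit. Based at that point the
    orbit maps identically to G, so its transfer is just the restriction. *)
Lemma mtr_to_reg M X (f : gmap X greg) (m : M X) :
  mtr M f m = \sum_(x | f x == 1%g :> gT) mres M (orb x) m.
Proof.
have [n] := ubnP #|X|; elim: n X f m => // n IHn X f m; rewrite ltnS => leX.
have [X0|/card_gt0P [x' _]] := posnP #|X|.
  by rewrite (kmod_card0 m X0) raddf0 big1 // => x; rewrite raddf0.
pose x := gset_act X x' (f x' : gT)^-1%g.
have fx1 : f x = 1%g by rewrite gmap_equiv /=; exact: mulgV.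
have [Y [j [ltY cop]]] := gset_split x.
(* The split-off orbit cannot be a fixed point, since X maps to G and G acts freely on itself. *)
have {}cop : is_coproduct (orb x) j.
  case: cop => // -[fx _]; have [g /eqP []] := exists_generator.
  by have := gmap_equiv f x g; rewrite fx fx1 /= mul1g.
rewrite {1}(mackey_decomp m cop) raddfD /= !mtr_comp.
have -> : gcomp f (orb x) = gid greg.
  by rewrite orb_comp fx1; apply: gmap_eq => g /=; rewrite mul1g.
rewrite mtr_id IHn; last exact: leq_trans leX.
rewrite [RHS](reindex _ (onW_bij _ cop)) big_sumType /=.
congr (_ + _).
  rewrite (big_pred1 (1%g : gT)) ?act1 // => g.
  by rewrite /= gmap_equiv fx1 /= mul1g.
by apply: eq_bigr => y _; rewrite mres_comp orb_comp.
Qed.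

Lemma mres_lam M X (x : X) h (m : M X) :
  mres M (lam h) (mres M (orb x) m) = mres M (orb (gset_act X x h)) m.
Proof. by rewrite mres_comp orb_lam. Qed.

Lemma mres_lamM M g h (m : M greg) :
  mres M (lam g) (mres M (lam h) m) = mres M (lam (h * g)%g) m.
Proof. exact: mres_lam. Qed.

Lemma mres_lam1 M (m : M greg) : mres M (lam (1%g : gT)) m = m.
Proof.
have -> : lam (1%g : gT) = gid greg by apply: gmap_eq => g /=; rewrite mul1g.
exact: mres_id.
Qed.

End PrimeOrder.

(** * Unipotent operators in characteristic p *)

Lemma iter_binomial (V : zmodType) (D : {additive V -> V}) n (m : V) :
  iter n (fun x => x + D x) m = \sum_(i < n.+1) iter i D m *+ 'C(n, i).
Proof.
elim: n => [|n IHn]; first by rewrite big_ord1.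
rewrite iterS IHn raddf_sum big_ord_recl [X in _ + X]big_ord_recr /=.
rewrite [RHS]big_ord_recl [in RHS]big_ord_recr /= !bin0 !binn -addrA.
congr (_ + _); rewrite addrA -big_split /= raddfMn; congr (_ + _).
by apply: eq_bigr => i _; rewrite raddfMn /= /bump /= binS mulrnDr add1n.
Qed.

(** The intermediate binomial coefficients are divisible by p, so (1 + D)^p = 1 + D^p. *)
Lemma iter_sub1_pchar (V : zmodType) (D : {additive V -> V}) p (m : V) :
  prime p -> (forall x : V, x *+ p = 0) -> iter p (fun x => x + D x) m = m ->
  iter p D m = 0.
Proof.
move=> p_prime Vp; rewrite iter_binomial; case: p p_prime Vp => // p p_prime Vp.
rewrite big_ord_recl big_ord_recr /= bin0 binn big1 => [|i _].
  by rewrite add0r => /eqP; rewrite -subr_eq0 addrAC subrr add0r => /eqP.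
have /dvdnP [q ->] : (p.+1 %| 'C(p.+1, bump 0 i))%N.
  by apply: prime_dvd_bin => //; rewrite /bump /= add1n ltnS ltn_ord.
by rewrite mulrnA Vp.
Qed.

(** * The constant functor and its free modules as invariant functions *)

Section ConstantFunctor.
Variables (gT : finGroupType) (F : comPzRingType).
Let k := constant_green gT F.
Implicit Types X Y Z : gset gT.

Definition cf X (a : k X) : X -> F := cst_fun (a : cst_val F X).

Lemma cf_eq X (a b : k X) : cf a =1 cf b -> a = b.
Proof. exact: cst_eq. Qed.
Lemma cf_act X (a : k X) x g : cf a (gset_act X x g) = cf a x.
Proof. exact: cst_funE. Qed.
Lemma cf_res X Y (f : gmap X Y) (a : k Y) x : cf (gres k f a) x = cf a (f x).
Proof. exact: ffunE. Qed.
Lemma cf_tr X Y (f : gmap X Y) (a : k X) y :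
  cf (gtr k f a) y = \sum_(x | f x == y) cf a x.
Proof. exact: ffunE. Qed.
Lemma cfD X (a b : k X) x : cf (a + b) x = cf a x + cf b x.
Proof. exact: ffunE. Qed.
Lemma cfN X (a : k X) x : cf (- a) x = - cf a x.
Proof. exact: ffunE. Qed.
Lemma cfM X (a b : k X) x : cf (a * b) x = cf a x * cf b x.
Proof. exact: ffunE. Qed.
Lemma cf0 X x : cf (0 : k X) x = 0.
Proof. exact: ffunE. Qed.
Lemma cf1 X x : cf (1 : k X) x = 1.
Proof. exact: ffunE. Qed.
Lemma cfMn X (a : k X) n x : cf (a *+ n) x = cf a x *+ n.
Proof. by elim: n => [|n IHn]; rewrite ?mulr0n ?cf0 // !mulrS cfD IHn. Qed.

Lemma cf_mk_inv X (c : X -> F) (cP : forall x g, c (gset_act X x g) = c x) :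
  [ffun x => c x] \in @cst_inv gT F X.
Proof. by apply/cst_invP => x g; rewrite !ffunE. Qed.
Definition cf_mk X (c : X -> F)
    (cP : forall x g, c (gset_act X x g) = c x) : k X :=
  CstVal (cf_mk_inv cP).
Lemma cf_mkE X c cP x : cf (@cf_mk X c cP) x = c x.
Proof. exact: ffunE. Qed.

(** Elements of k_X(Z) are seen as matrices with rows X and columns Z, invariant under the diagonal
    action; restriction in either variable reindexes, and transfer in X sums over fibres. *)
Definition cf2 X Z (a : kfreeon k X Z) (x : X) (z : Z) : F :=
  cf (a : k (gprod X Z)) (x, z).

Lemma cf2_eq X Z (a b : kfreeon k X Z) :
  (forall x z, cf2 a x z = cf2 b x z) -> a = b.
Proof. by move=> E; apply: cf_eq => -[x z]; apply: E. Qed.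
Lemma cf2_act X Z (a : kfreeon k X Z) x z g :
  cf2 a (gset_act X x g) (gset_act Z z g) = cf2 a x z.
Proof. exact: (@cf_act (gprod X Z) a (x, z) g). Qed.
Lemma cf2_zero X Z x z : cf2 (0 : kfreeon k X Z) x z = 0.
Proof. exact: cf0. Qed.
Lemma cf2_shift X Y Z (f : gmap Y Z) (a : kfreeon k X Z) x y :
  cf2 (mres (kfreeon k X) f a) x y = cf2 a x (f y).
Proof. exact: cf_res. Qed.
Lemma cf2_arg X X' Z (f : gmap X X') (a : kfreeon k X' Z) x z :
  cf2 (arg_res (kreg k) f Z a) x z = cf2 a (f x) z.
Proof. exact: cf_res. Qed.
Lemma cf2_tr X X' Z (f : gmap X X') (a : kfreeon k X Z) x' z :
  cf2 (arg_tr (kreg k) f Z a) x' z = \sum_(x | f x == x') cf2 a x z.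
Proof.
rewrite [LHS]cf_tr (reindex (fun x : X => (x, z) : gprod X Z)) /=.
  by apply: eq_bigl => x; rewrite xpair_eqE eqxx andbT.
by exists fst => [x _|[x z1]] //; rewrite inE /= => /eqP [_ ->].
Qed.

Definition cf2_mk X Z (c : X -> Z -> F)
    (cP : forall x z g, c (gset_act X x g) (gset_act Z z g) = c x z) :
  kfreeon k X Z :=
  @cf_mk (gprod X Z) (fun q => c q.1 q.2) (fun q => cP q.1 q.2).
Lemma cf2_mkE X Z c cP x z : cf2 (@cf2_mk X Z c cP) x z = c x z.
Proof. exact: cf_mkE. Qed.

Definition cconst X (c : F) : k X := cf_mk (fun (_ : X) (_ : gT) => erefl c).
Lemma cconstE X c x : cf (cconst X c) x = c.
Proof. exact: cf_mkE. Qed.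

Lemma cf_reg (a : k greg) g : cf a g = cf a (1%g : gT).
Proof. by rewrite -(cf_act a (1%g : gT) g) /= mul1g. Qed.

Lemma mulrn_pchar p (M : kmod k) X (m : M X) :
  p%:R = 0 :> F -> m *+ p = 0.
Proof.
move=> pF0; rewrite -[m]scale1r scalerMnl.
have -> : 1 *+ p = 0 :> k X.
  by apply: cf_eq => x; rewrite cfMn cf1 cf0.
exact: scale0r.
Qed.

End ConstantFunctor.

(** * The operator g - 1 on level G *)

Section FlatPrime.
Variables (gT : finGroupType) (p : nat) (F : fieldType).
Hypotheses (p_prime : prime p) (charF : p \in [pchar F]).
Hypothesis orderG : #|[set: gT]| = p.
Let k := constant_green gT F.
Implicit Types X Y Z : gset gT.
Implicit Types M N : kmod k.

Variables (g0 : gT) (g0n1 : g0 != 1%g).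

Definition lamsub M (m : M greg) := mres M (lam g0) m - m.
Lemma lamsub_additive M : zmod_morphism (@lamsub M).
Proof.
move=> x y; rewrite /lamsub raddfB !opprB addrACA [RHS]addrACA.
by congr (_ + _); apply: addrC.
Qed.
HB.instance Definition _ M := GRing.isZmodMorphism.Build (M greg) (M greg)
  (@lamsub M) (@lamsub_additive M).

Lemma lamsubZ M (c : k greg) (m : M greg) : lamsub (c *: m) = c *: lamsub m.
Proof.
rewrite /lamsub mresZ scalerBr; congr (_ *: _ - _).
by apply: cf_eq => g; rewrite cf_res cf_reg [RHS]cf_reg.
Qed.

Lemma lamsub_lam M h (m : M greg) :
  mres M (lam h) (lamsub m) = lamsub (mres M (lam h) m).
Proof.
rewrite /lamsub raddfB !mres_lamM.
by rewrite (prime_mulgC p_prime orderG).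
Qed.

Lemma hom_lamsub M N (f : khom M N) m : f greg (lamsub m) = lamsub (f greg m).
Proof. by rewrite /lamsub linearB /= hval_res. Qed.

(** In characteristic p, (g0 - 1)^p = g0^p - 1 = 0. *)
Lemma lamsub_nilp M (m : M greg) : iter p (@lamsub M) m = 0.
Proof.
apply: iter_sub1_pchar => // [x|]; first exact: mulrn_pchar (pcharf0 charF).
have E n : iter n (fun x => x + lamsub x) m = mres M (lam (g0 ^+ n)%g) m.
  elim: n => [|n IHn]; first by rewrite /= mres_lam1.
  by rewrite iterS IHn /lamsub addrC subrK mres_lamM expgSr.
rewrite E -orderG (_ : (g0 ^+ #|[set: gT]|)%g = 1%g).
  by rewrite mres_lam1.
by apply: expg_cardG; rewrite inE.
Qed.

(** Substituting M(G) = R(G) + (g0 - 1) M(G) into itself repeatedly leaves R(G) + (g0 - 1)^p M(G),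
    and the last term is zero. *)
Lemma lamsub_nakayama M (R : ksub M) :
  (forall m : M greg, exists r t, R greg r /\ m = r + lamsub t) ->
  forall m : M greg, R greg m.
Proof.
move=> gen m.
have Riter n r : R greg r -> R greg (iter n (@lamsub M) r).
  move=> Rr; elim: n => // n IHn.
  by rewrite iterS; apply: kinB => //; apply: kin_res.
have [r [t [Rr ->]]] : exists r t, R greg r /\ m = r + iter p (@lamsub M) t.
  elim: (p) => [|n [r [t [Rr ->]]]].
    by exists 0, m; rewrite add0r; split=> //; apply: kin0.
  have [r' [t' [Rr' ->]]] := gen t.
  exists (r + iter n (@lamsub M) r'), t'.
  split; first exact: kinD (Riter _ _ _).
  rewrite -addrA iterSr; congr (_ + _).
  by elim: n => // n IHn; rewrite !iterS IHn raddfD.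
by rewrite lamsub_nilp addr0.
Qed.

(** The last nonzero iterate of g0 - 1 on m is fixed by g0, and the iterates stay in the kernel of
    f. *)
Lemma lamsub_fixed M N (f : khom M N) (m : M greg) : m != 0 -> f greg m = 0 ->
  exists m' : M greg, [/\ m' != 0, f greg m' = 0 & mres M (lam g0) m' = m'].
Proof.
move=> m0 fm0.
have exn : exists n, iter n (@lamsub M) m == 0 by exists p; rewrite lamsub_nilp.
case: (ex_minnP exn) => -[|n] /eqP n0 min_n; first by rewrite -n0 eqxx in m0.
exists (iter n (@lamsub M) m); split.
- by apply/negP => /min_n; rewrite ltnn.
- elim: (n) => // i IHi; rewrite iterS hom_lamsub IHi; exact: raddf0.
- by apply/eqP; rewrite -subr_eq0; apply/eqP.
Qed.

Definition lamsub_hom M : khom (shift M greg) (shift M greg) :=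
  khom_sub (arg_res M (lam g0)) (khom_id _).

(** Under M (x) k_X = M(X * -), restriction in X is induced by a map of free modules; likewise for
    transfer and g0 - 1 below. Flatness is tested on these maps. *)
Lemma arg_res_theta M X X' (f : gmap X X') :
  is_relbox_map (theta M X') (theta M X) (arg_res (kreg k) f) (arg_res M f).
Proof.
move=> Z m a; rewrite thetaE arg_resE mresZ mres_comp thetaE.
by congr (_ *: mres M _ _); apply: gmap_eq.
Qed.

Lemma arg_tr_theta M X X' (f : gmap X X') :
  is_relbox_map (theta M X) (theta M X') (arg_tr (kreg k) f) (arg_tr M f).
Proof.
move=> Z m a; rewrite thetaE arg_trE thetaE arg_trE -mtr_frobl mres_comp.
by congr (mtr M _ (_ *: mres M _ _)); apply: gmap_eq.
Qed.

Lemma lamsub_theta M : is_relbox_map (theta M greg) (theta M greg)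
  (lamsub_hom (kreg k)) (lamsub_hom M).
Proof.
move=> Z m a; rewrite /= -!/(arg_res _ _ _ _).
rewrite -[arg_res_fun _ _]/(arg_res M (lam g0) Z _).
rewrite (arg_res_theta (lam g0) m a).
by rewrite /= /theta_fun scalerBl.
Qed.

(** [at_pt] and [of_pt] identify M(X) with the value of M(X * -) at a point. *)
Definition at_pt M X (v : M X) : shift M X gpt := mres M (gfst X gpt) v.
Definition of_pt M X (w : shift M X gpt) : M X :=
  mres M (gpair (gid X) (to_pt X)) w.
Lemma at_ptK M X (v : M X) : of_pt (at_pt v) = v.
Proof.
rewrite /of_pt /at_pt mres_comp.
have -> : gcomp (gfst X gpt) (gpair (gid X) (to_pt X)) = gid X.
  exact: gmap_eq.
exact: mres_id.
Qed.
Lemma of_ptK M X (w : shift M X gpt) : at_pt (of_pt w) = w.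
Proof.
rewrite /of_pt /at_pt mres_comp.
have -> : gcomp (gpair (gid X) (to_pt X)) (gfst X gpt) = gid (gprod X gpt).
  by apply: gmap_eq => -[x []].
exact: (@mres_id _ _ M).
Qed.
Lemma at_pt_res M X X' (f : gmap X X') (v : M X') :
  arg_res M f gpt (at_pt v) = at_pt (mres M f v).
Proof.
rewrite arg_resE /at_pt !mres_comp; congr (mres M _ _); exact: gmap_eq.
Qed.
Lemma at_pt_tr M X X' (f : gmap X X') (v : M X) :
  arg_tr M f gpt (at_pt v) = at_pt (mtr M f v).
Proof.
rewrite arg_trE /at_pt; symmetry.
apply: (@mtr_pullback _ _ M _ _ _ _
  f (gfst X' gpt) (arg_map f gpt) (gfst X gpt)).
split=> [[x t]|x [x' t] /= fx] //; exists (x, t); split; first by rewrite /= fx.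
by move=> [x1 t1] /= [<- [_ <-]].
Qed.

(** * Restriction and transfer between a point and G for flat modules *)

Section Tests.
Variables (M : kmod k) (flatM : kflat M).
Let c := to_pt (@greg gT).


Lemma flat_shift_ker X X' (bk : khom (kfreeon k X) (kfreeon k X'))
    (bM : khom (shift M X) (shift M X')) (R : ksub (shift M X)) :
  is_relbox_map (theta M X) (theta M X') bk bM ->
  (forall Z (m : M Z) a, bk Z a = 0 -> R Z (theta M X Z m a)) ->
  forall Z w, bM Z w = 0 -> R Z w.
Proof. by apply: flat_ker => //; apply: theta_relbox. Qed.

(** Pulling functions back along G -> pt is injective, so k_pt -> k_G is a monomorphism; flatness
    keeps it injective after tensoring with M, and its value at a point is the restriction M(pt) ->
    M(G). The kernel of the identity serves as the zero submodule. *)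
Lemma flat_res_inj (u : M gpt) : mres M c u = 0 -> u = 0.
Proof.
move=> cu0; rewrite -[u]at_ptK.
have -> : at_pt u = 0; last by rewrite /of_pt raddf0.
apply: (flat_shift_ker (R := kker (khom_id _)) (arg_res_theta (M := M) c)).
  move=> Z m a a0; have -> : a = 0.
    apply: cf2_eq => -[] z; have := cf2_arg c a (1%g : gT) z.
    by rewrite a0 !cf2_zero.
  by rewrite thetaE scale0r.
by rewrite at_pt_res cu0 /at_pt raddf0.
Qed.

Lemma lamsub_pt (v : M greg) : lamsub_hom M gpt (at_pt v) = at_pt (lamsub v).
Proof.
by rewrite /lamsub /at_pt raddfB -!/(at_pt _) -at_pt_res.
Qed.

Lemma cf2_lamsub Z (a : kfreeon k greg Z) h z :
  cf2 (lamsub_hom (kreg k) Z a) h z = cf2 a (g0 * h)%g z - cf2 a h z.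
Proof. by rewrite [LHS]cfD cfN; congr (_ - _); apply: cf2_arg. Qed.

Lemma lamsub_fixed_ker Z (a : kfreeon k greg Z) :
  (forall h z, cf2 a (g0 * h)%g z = cf2 a h z) ->
  exists b, a = arg_res (kreg k) c Z b.
Proof.
move=> aE.
have a1 h z : cf2 a h z = cf2 a (1%g : gT) z.
  have [i ->] := cycle_prime_order p_prime orderG g0n1 h.
  by elim: i => // i IHi; rewrite expgS aE IHi.
have bP (x : @gpt gT) z g :
    cf2 a (1%g : gT) (gset_act Z z g) = cf2 a (1%g : gT) z.
  by rewrite -(a1 (gset_act greg (1%g : gT) g)) cf2_act.
exists (cf2_mk bP); apply: cf2_eq => h z.
by rewrite cf2_arg cf2_mkE a1.
Qed.

(** Discrete integration on a cyclic group: the partial sums S of f along the powers of g0 are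
    p-periodic because the total is zero, so they descend to a function on G. *)
Lemma difference_eq (V : zmodType) (f : gT -> V) : \sum_x f x = 0 ->
  exists d : gT -> V, forall x, d (g0 * x)%g - d x = f x.
Proof.
move=> f0; pose S n := \sum_(0 <= i < n) f (g0 ^+ i)%g.
have og0 := order_prime p_prime orderG g0n1.
have Sp : S p = 0.
  rewrite /S big_mkord; apply: etrans f0.
  rewrite [RHS](reindex (fun i : 'I_p => (g0 ^+ i)%g)) //.
  apply: onW_bij; apply: inj_card_bij => [i j /eqP|]; last first.
    by rewrite card_ord -orderG cardsT.
  by rewrite eq_expg_mod_order og0 !modn_small ?ltn_ord // => /eqP /val_inj.
have Sadd n : S (n + p)%N = S n.
  rewrite /S addnC (big_cat_nat (n := p)) ?leq_addr //= [X in X + _]Sp add0r.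
  rewrite -{1}[p]add0n big_addn addKn; apply: eq_bigr => i _.
  by rewrite expgD -og0 expg_order mulg1.
have Smod n : S n = S (n %% p)%N.
  rewrite {1}(divn_eq n p); elim: (n %/ p)%N => // q IHq.
  by rewrite mulSn -addnA addnC Sadd.
(* [e x] is a discrete logarithm of x to the base g0; S depends on it only modulo p. *)
have [e eE] := choice (cycle_prime_order p_prime orderG g0n1).
exists (S \o e) => x /=; have -> : S (e (g0 * x)%g) = S (e x).+1.
  rewrite Smod [RHS]Smod; congr S; apply/eqP.
  by rewrite -og0 -eq_expg_mod_order -eE expgS -eE.
by rewrite /S big_nat_recr //= -eE addrAC subrr add0r.
Qed.

(* On the diagonal orbits of G * Z, a function of total sum zero is a
   difference; on the fixed points of Z it is constant along G. *)
Lemma tr_ker_lamsub Z (a : kfreeon k greg Z) :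
  arg_tr (kreg k) c Z a = 0 ->
  exists b d, a = lamsub_hom (kreg k) Z b + arg_res (kreg k) c Z d.
Proof.
pose K Z (a : kfreeon k greg Z) := arg_tr (kreg k) c Z a = 0.
pose R := ksub_add (kim (lamsub_hom (kreg k))) (kim (arg_res (kreg k) c)).
suff KR : K Z a -> R Z a.
  by move=> /KR [x [y [[b <-] [d <-] ->]]]; exists b, d.
apply: (ksub_orbits p_prime orderG) => {Z a} [X Y f a Ka|a Ka|a Ka].
- by rewrite /K hval_res Ka raddf0.
- have [h z|d ->] := @lamsub_fixed_ker gpt a; last first.
    exists 0, (arg_res (kreg k) c gpt d); split; last by rewrite add0r.
      exact: kin0.
    by exists d.
  have a1 (h' : gT) : cf2 a h' z = cf2 a (1%g : gT) z.
    by rewrite -(cf2_act a (1%g : gT) z h'); congr (cf2 a); exact/esym/mul1g.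
  by rewrite a1 [RHS]a1.
(* An invariant function on G * G depends only on h z^-1, and the vanishing of its transfer says
   that f has total sum zero. *)
pose f (x : gT) : F := cf2 a x (1%g : gT).
have aE (h z : gT) : cf2 a h z = f (h * z^-1)%g.
  rewrite /f -(cf2_act a h z z^-1%g).
  by congr (cf2 a _ _); exact: mulgV.
have [d dE] : exists d : gT -> F, forall x, d (g0 * x)%g - d x = f x.
  apply: difference_eq; have := cf2_tr c a tt (1%g : gT).
  by rewrite Ka cf2_zero => a0; apply: etrans (esym a0); apply: eq_bigl.
have bP (x z : greg) g :
    d ((gset_act greg x g : gT) * (gset_act greg z g : gT)^-1)%g =
    d ((x : gT) * (z : gT)^-1)%g.
  by rewrite /= invMg mulgA mulgK.
exists (lamsub_hom (kreg k) greg (cf2_mk bP)), 0; split.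
- by exists (cf2_mk bP).
- exact: kin0.
rewrite addr0; apply: cf2_eq => h z.
by rewrite aE -dE cf2_lamsub !cf2_mkE /= mulgA.
Qed.

(** The kernel of the transfer k_G -> k_pt lies in (g0 - 1) k_G + res k_pt; flatness carries this
    inclusion over to M(G * -), and its value at a point gives the claim. *)
Lemma flat_tr_ker (v : M greg) : mtr M c v = 0 ->
  exists t u, v = lamsub t + mres M c u.
Proof.
move=> cv.
pose R := ksub_add (kim (lamsub_hom M)) (kim (arg_res M c)).
have [||x [y [[b bE] [d dE] vE]]] :=
  flat_shift_ker (R := R) (arg_tr_theta (M := M) c) _ (Z := gpt) (w := at_pt v).
- move=> Z m a /tr_ker_lamsub [b [d ->]]; rewrite pairDr.
  exists (theta M greg Z m (lamsub_hom _ Z b)).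
  exists (theta M greg Z m (arg_res _ c Z d)).
  split=> //; [exists (theta M greg Z m b)|exists (theta M gpt Z m d)].
    exact: lamsub_theta.
  exact: arg_res_theta.
- by rewrite at_pt_tr cv /at_pt raddf0.
exists (of_pt b), (of_pt d); rewrite -[LHS]at_ptK vE -bE -dE.
rewrite -{1}[b]of_ptK -{1}[d]of_ptK lamsub_pt // at_pt_res /of_pt raddfD.
by rewrite -!/(of_pt _) !at_ptK.
Qed.

End Tests.
End FlatPrime.

(** * Minimal generators *)

Section Generation.
Variables (gT : finGroupType) (k : cgreen gT).
Implicit Types X Y Z : gset gT.

(** A single v records a finite generating family, since X may have several orbits. *)
Definition kgen (M : kmod k) X (v : M X) : Prop :=
  forall R : ksub M, R X v -> forall Z m, R Z m.

Lemma kgen_surj (M : kmod k) X (v : M X) : kgen v -> ksurjective (free_ind v).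
Proof.
move=> gen Z m; apply: (gen (kim (free_ind v))).
by exists (free_gen k X); exact: free_ind_gen.
Qed.

Lemma coproduct_elt (M : kmod k) X Y (x : M X) (y : M Y) :
  exists v : M (gsum X Y), mres M (ginl X Y) v = x /\ mres M (ginr X Y) v = y.
Proof.
have [v [vE _]] := mackey_add (kmod_mackey M) (gsum_coproduct X Y) x y.
by exists v.
Qed.

(** Additivity packs a finite family into one element on the disjoint union; the empty family
    becomes 0 on the empty G-set. *)
Lemma join_elts (M : kmod k) (n : nat) (X : 'I_n -> gset gT)
    (v : forall i, M (X i)) :
  exists Y (w : M Y), forall R : ksub M, R Y w -> forall i, R (X i) (v i).
Proof.
elim: n X v => [|n IHn] X v; first by exists gempty, 0 => R _ [].
have [Y [w wP]] := IHn _ (fun i => v (lift ord0 i)).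
have [w' [w1 w2]] := coproduct_elt (v ord0) w.
exists (gsum (X ord0) Y), w' => R Rw' i.
case: (unliftP ord0 i) => [j ->|->]; last by rewrite -w1; apply: kin_res.
by apply: wP; rewrite -w2; apply: kin_res.
Qed.

(** The images of the free generators in M are joined into one element w. For a submodule R
    containing w, the composite S -> M -> M/R vanishes on all generators, hence is zero, and R = M
    by surjectivity. *)
Lemma fg_kgen (M : kmod k) :
  kfinitely_generated M -> exists X (v : M X), kgen v.
Proof.
case=> n [P [S [inj [q [freeP sumS surj_q]]]]].
pose X i := sval (cid (freeP i)).
pose u i : P i (X i) := sval (cid (svalP (cid (freeP i)))).
have free_u i : free_on (u i).
  exact: svalP (cid (svalP (cid (freeP i)))).
have [Y [w wP]] := join_elts (fun i => q (X i) (inj i (X i) (u i))).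
exists Y, w => R Rw Z m.
have [s <-] := surj_q Z m; apply/kproj_eq0.
have [h _ uh] := sumS (kquot R) (fun i => khom_zero (P i) (kquot R)).
have -> : kproj R Z (q Z s) = h Z s.
  2: by symmetry; apply: (uh (khom_zero _ _)).
apply: (uh (khom_comp (kproj R) q)) => i W x.
have [h' _ uh'] := free_u i (kquot R) 0.
transitivity (h' W x); last by symmetry; apply: (uh' (khom_zero _ _)).
apply: (uh' (khom_comp (khom_comp (kproj R) q) (inj i))).
by apply/kproj_eq0; apply: wP.
Qed.

Lemma projective_retract (M : kmod k) X (v : M X) : kprojective M -> kgen v ->
  exists s : khom M (kfreeon k X), forall Z m, free_ind v Z (s Z m) = m.
Proof. by move=> projM /kgen_surj /(projM _ _ _ (khom_id M)). Qed.

End Generation.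

(** * Flat modules over a group of prime order are free *)

Section Main.
Variables (gT : finGroupType) (p : nat) (F : fieldType).
Hypotheses (p_prime : prime p) (charF : p \in [pchar F]).
Hypothesis orderG : #|[set: gT]| = p.
Let k := constant_green gT F.
Implicit Types X Y Z : gset gT.
Implicit Types M N : kmod k.

Lemma cf_unit_kin N (R : ksub N) Z (a : k Z) (b : F) (n : N Z) :
  b != 0 -> (forall z, cf a z = b) -> R Z (a *: n) -> R Z n.
Proof.
move=> b0 ab /(kinZ (cconst Z b^-1)); rewrite scalerA.
have -> : (cconst Z b^-1) * a = 1; last by rewrite scale1r.
by apply: cf_eq => z; rewrite cfM cconstE ab mulVf // cf1.
Qed.

(** Orbit by orbit, fixed points contribute nothing and the transfer from a free orbit factors
    through G. The last clause records that w is built from y by module operations. *)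
Lemma tr_free_support M Y (a : k Y) (y : M Y) :
  (forall x, (forall g, gset_act Y x g = x) -> cf a x = 0) ->
  exists w, mtr M (to_pt Y) (a *: y) = mtr M (to_pt greg) w /\
    forall R : ksub M, R Y y -> R greg w.
Proof.
have [n] := ubnP #|Y|; elim: n Y a y => // n IHn Y a y; rewrite ltnS => leY a0.
have [Y0|/card_gt0P [x _]] := posnP #|Y|.
  exists 0; split=> [|R _]; last exact: kin0.
  by rewrite (kmod_card0 y Y0) scaler0 !raddf0.
have [Z [j [ltZ cop]]] := gset_split p_prime orderG x.
have [|w [wE wP]] := IHn Z (gres k j a) (mres M j y) (leq_trans ltZ leY).
  by move=> z fz; rewrite cf_res a0 // => g; rewrite -gmap_equiv fz.
case: cop => [[fx cop]|cop];
  rewrite (mackey_decomp (a *: y) cop) raddfD /= !mtr_comp !to_pt_comp.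
  exists w; split=> [|R Ry]; last by apply: wP; apply: kin_res.
  rewrite -wE mresZ (_ : gres k (fixpt fx) a = 0).
    by rewrite scale0r raddf0 add0r mresZ.
  by apply: cf_eq => t; rewrite cf_res cf0 a0.
exists (mres M (orb x) (a *: y) + w); split=> [|R Ry].
  by rewrite raddfD -wE !mresZ.
by apply: kinD; [apply/kin_res/kinZ|apply/wP/kin_res].
Qed.

Section Minimal.
Variables (M : kmod k) (flatM : kflat M) (X : gset gT) (v : M X).
Hypothesis gen_v : kgen v.

(** Level G of k_X -> M made explicit: the transfer along X * G -> G is a sum over the fibre at 1,
    which is a copy of X. *)
Lemma kgen_span (m : M greg) : exists c : X -> k greg,
  m = \sum_x c x *: mres M (orb x) v.
Proof.
have [a <-] := kgen_surj gen_v m.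
exists (fun x => gres k (gpair (orb x) (gid greg)) a).
rewrite free_indE (mtr_to_reg p_prime orderG).
rewrite (reindex (fun x : X => (x, (1%g : gT)) : gprod X greg)) /=; last first.
  by exists fst => [x _ //|[x g] /=]; rewrite inE => /eqP /= ->.
apply: eq_big => x; rewrite ?eqxx // => _; rewrite mresZ mres_comp.
have -> : orb ((x, (1%g : gT)) : gprod X greg) = gpair (orb x) (gid greg).
  by apply: gmap_eq => g; rewrite /= /prod_act /= mul1g.
by congr (_ *: mres M _ _); apply: gmap_eq.
Qed.

(* A nonzero kernel is nonzero at G/e, where the p-group G fixes a nonzero
   vector; as M(G/G) embeds in M(G/e), this vector is a relation in M(G/G). *)
Lemma kernel_fixed : ~ (forall Z, injective (free_ind v Z)) ->
  exists (a : k X) x, cf a x != 0 /\ mtr M (to_pt X) (a *: v) = 0.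
Proof.
have [g0 g0n1] := exists_generator p_prime orderG.
move=> ninj.
have [a an0 fa0] : exists2 a : kfreeon k X greg, a != 0 & free_ind v greg a = 0.
  apply: contrapT => no_a; apply: ninj => Z; apply: injective_ker0 => a fa0.
  apply: cf2_eq => x z; rewrite cf2_zero.
  (* The entries of a can be read off from its restrictions along the maps G -> Z, so a nonzero
     kernel element stays nonzero under one of them. *)
  have az0 : mres (kfreeon k X) (orb z) a = 0.
    apply: contrapT => /eqP az; apply: no_a.
    by exists (mres (kfreeon k X) (orb z) a); rewrite // hval_res fa0 raddf0.
  have := cf2_shift (orb z) a x (1%g : gT).
  by rewrite az0 cf2_zero /= act1.
have [b [bn0 fb0 lb]] := lamsub_fixed p_prime charF orderG g0 an0 fa0.
(* Being fixed by g0, b does not depend on its G variable, so it is pulled back from a function on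
   X. *)
have b1 x h : cf2 b x h = cf2 b x (1%g : gT).
  have [i ->] := cycle_prime_order p_prime orderG g0n1 h.
  by elim: i => // i <-; rewrite expgS -[in RHS]lb cf2_shift.
have kP x g : cf2 b (gset_act X x g) (1%g : gT) = cf2 b x (1%g : gT).
  by rewrite -(b1 _ (gset_act greg (1%g : gT) g)) cf2_act.
pose a0 : k X := cf_mk kP.
have ba0 : b = gres k (gfst X greg) a0.
  by apply: cf2_eq => x h; rewrite b1 [RHS]cf_res cf_mkE.
have [x a0x] : exists x, cf a0 x != 0.
  apply: contrapT => no_x; case/eqP: bn0; rewrite ba0; apply: cf2_eq => x h.
  rewrite cf2_zero [LHS]cf_res; apply: contrapT => /eqP ax; apply: no_x.
  by exists x.
(* Base change identifies the image of b, which is zero, with the restriction to G of the transfer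
   of [a0 *: v]; injectivity of restriction then gives the relation at the point. *)
exists a0, x; split=> //; apply: (flat_res_inj flatM).
rewrite -fb0 ba0 free_indE -mresZ; apply: mtr_pullback.
split=> // y g _; exists (y, g); split=> //.
by move=> [y' g'] /= [-> ->].
Qed.

(** A nonzero kernel gives a relation Tr(a v) = 0 with a nonzero; from it a generator over a G-set
    with fewer points is built, against minimality. *)
Lemma minimal_injective :
  (forall Y (w : M Y), kgen w -> (#|X| <= #|Y|)%N) ->
  forall Z, injective (free_ind v Z).
Proof.
have [g0 g0n1] := exists_generator p_prime orderG.
move=> minX; apply: contrapT => /kernel_fixed [a [x1 [ax1 trav]]].
have drop Y (w : M Y) : kgen w -> (#|Y| < #|X|)%N -> False.
  by move=> /minX; rewrite leqNgt => /negP.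
(* A generator at a fixed point with nonzero coefficient is redundant. *)
have [[x0 fx0 ax0]|no_fixed] := pselect (exists2 x : X,
    forall g, gset_act X x g = x & cf a x != 0).
  have [Y [j [ltY cop]]] := gset_split p_prime orderG x0.
  have {}cop : exists fx, is_coproduct (@fixpt _ X x0 fx) j.
    case: cop => // -[s sK _]; case/eqP: g0n1.
    have := sK (inl 1%g); have := sK (inl g0).
    by rewrite /= !fx0 => -> [].
  have [fx {}cop] := cop.
  apply: (drop _ (mres M j v)) => // R Rv; apply: gen_v.
  rewrite (mackey_decomp v cop); apply: kinD; apply: kin_tr => //.
  (* The relation expresses a(x0) times the component at x0 through transfers of the others, and the
     nonzero scalar a(x0) is invertible. *)
  apply: (cf_unit_kin (a := gres k (fixpt fx) a) ax0) => [t|].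
    exact: cf_res.
  move: trav; rewrite (mackey_decomp (a *: v) cop) raddfD /= !mtr_comp.
  rewrite !to_pt_comp (_ : to_pt (@gpt gT) = gid gpt).
    2: by apply: gmap_eq => -[].
  rewrite mtr_id !mresZ => /eqP; rewrite addr_eq0 => /eqP ->.
  by apply/kinN/kin_tr/kinZ.
have [Y [j [ltY cop]]] := gset_split p_prime orderG x1.
have {}cop : is_coproduct (orb x1) j.
  by case: cop => // -[fx _]; case: no_fixed; exists x1.
set e := mres M (orb x1) v; set v1 := mres M j v.
(* No fixed point occurs in the relation, so the orbits other than that of x1 contribute the
   transfer of a single w1 in M(G). *)
have [|w1 [w1E w1P]] := tr_free_support (a := gres k j a) v1.
  move=> y fy; apply: contrapT => /eqP ay; apply: no_fixed; exists (j y).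
    by move=> g; rewrite -gmap_equiv fy.
  by rewrite -cf_res.
pose a1 := gres k (orb x1) a.
have a1E h : cf a1 h = cf a x1 by rewrite cf_res /= cf_act.
have tr0 : mtr M (to_pt greg) (a1 *: e + w1) = 0.
  rewrite raddfD -w1E; apply: etrans trav.
  rewrite [in RHS](mackey_decomp (a *: v) cop).
  by rewrite raddfD /= !mtr_comp !to_pt_comp !mresZ.
have [t [b tb]] := flat_tr_ker p_prime orderG g0n1 flatM tr0.
(* Modulo the image of g0 - 1 and the other generators, [e] is a multiple of
   the restriction of [b], so [b] can replace it, by Nakayama. *)
have [v' [v'1 v'2]] := coproduct_elt v1 b.
(* An orbit of p points gives way to one point, so the new G-set is smaller. *)
apply: (drop _ v'); last first.
  have regp : #|@greg gT| = p by rewrite -orderG cardsT.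
  rewrite card_sum card_unit -(bij_eq_card cop) card_sum regp addnC.
  by rewrite ltn_add2r prime_gt1.
move=> R Rv'.
have Rv1 : R Y v1 by rewrite -v'1; apply: kin_res.
have Rb : R gpt b by rewrite -v'2; apply: kin_res.
(* T is R(G) + (g0 - 1) M(G); once e lies in it, all of M(G) does, and Nakayama gives R(G) =
   M(G). *)
pose T m := exists r s, R greg r /\ m = r + lamsub g0 s.
have TD m m' : T m -> T m' -> T (m + m').
  move=> [r [s [Rr ->]]] [r' [s' [Rr' ->]]]; exists (r + r'), (s + s').
  by split; [apply: kinD|rewrite raddfD addrACA].
have TZ c m : T m -> T (c *: m).
  move=> [r [s [Rr ->]]]; exists (c *: r), (c *: s).
  by split; [apply: kinZ|rewrite lamsubZ scalerDr].
have Tlam h m : T m -> T (mres M (lam h) m).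
  move=> [r [s [Rr ->]]]; exists (mres M (lam h) r), (mres M (lam h) s).
  by split; [apply: kin_res|rewrite raddfD /= (lamsub_lam p_prime orderG)].
have Te : T e.
  have -> : e = cconst greg (cf a x1)^-1 *: (a1 *: e).
    rewrite scalerA (_ : _ * _ = 1) ?scale1r //.
    by apply: cf_eq => h; rewrite cfM cconstE a1E mulVf // cf1.
  apply: TZ; exists (mres M (to_pt greg) b - w1), t; split.
    by apply: kinB; [apply: kin_res|apply: w1P].
  by rewrite -[LHS](addrK w1) tb -addrA addrC -addrA.
have Rgreg m : R greg m.
  apply: (lamsub_nakayama p_prime charF orderG (g0 := g0)) => {}m.
  have [c ->] := kgen_span m.
  apply: (big_ind T) => [|//|x _].
    by exists 0, 0; split; [exact: kin0|rewrite raddf0 addr0].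
  (* A point of the orbit of x1 contributes a translate of e, any other point a component of v1,
     already in R. *)
  apply: TZ; have [s _ sK] := cop; rewrite -[x]sK; case: (s x) => [h|y].
    by rewrite -(mres_lam x1 h v); apply: Tlam.
  exists (mres M (orb y) v1), 0; rewrite raddf0 addr0 mres_comp orb_comp.
  by split=> //; rewrite -orb_comp -mres_comp; apply: kin_res.
apply: gen_v; rewrite (mackey_decomp v cop).
by apply: kinD; apply: kin_tr.
Qed.

End Minimal.

(** A generator over a G-set with the fewest points generates M freely, by minimality. *)
Lemma flat_free M : kfinitely_generated M -> kflat M -> kfree M.
Proof.
move=> /fg_kgen [X [v gen_v]] flatM.
pose P n := `[< exists Y (w : M Y), #|Y| = n /\ kgen w >].
have exP : exists n, P n by exists #|X|; apply/asboolP; exists X, v.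
case: (ex_minnP exP) => n /asboolP [Y [w [<- gen_w]]] minY.
apply: (@free_on_kfree _ _ _ Y w); apply: free_on_iso (kgen_surj gen_w).
apply: minimal_injective => // Z z gen_z; apply: minY.
by apply/asboolP; exists Z, z.
Qed.

(** Lifting the identity along the surjection k_X -> M makes M a retract of k_X. *)
Lemma projective_flat M : kfinitely_generated M -> kprojective M -> kflat M.
Proof.
move=> /fg_kgen [X [v gen_v]] projM.
have [s sK] := projective_retract projM gen_v.
exact: retract_flat sK.
Qed.

End Main.

Theorem theorem8 (p : nat) (F : fieldType) (gT : finGroupType)
    (p_prime : prime p) (charF : p \in [pchar F])
    (cyclicG : cyclic [set: gT]) (orderG : #|[set: gT]| = p)
    (M : kmod (constant_green gT F)) (fgM : kfinitely_generated M) :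
  [<-> kflat M; kprojective M; kfree M].
Proof.
(* Flat implies projective through freeness, and projective implies free through flatness. *)
split=> [flatM|]; first exact/kfree_projective/(flat_free p_prime charF orderG).
split=> [projM|/kfree_projective]; last exact: projective_flat.
exact: (flat_free p_prime charF orderG) (projective_flat fgM projM).
Qed.
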